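(* Let $-1<\alpha<2$ and $n\in\mathbb{N}_0$. The Fisher information with respect to $\alpha$ of the Grosjean polynomial of the second kind $g_n^{(\alpha)}(x)$, $$I_n^{(g)}(\alpha)=4\int_{-1}^1\left\{\frac{\partial}{\partial\alpha}\Big(\big[\omega_g(x;\alpha)\big]^{1/2}\,\tilde g_n^{(\alpha)}(x)\Big)\right\}^2dx,\qquad \omega_g(x;\alpha)=\left(\frac{1-x}{1+x}\right)^{\alpha}(1+x),$$ where $\tilde g_n^{(\alpha)}$ is the corresponding orthonormal polynomial, has the value $$I_n^{(g)}(\alpha)=8\sum_{k=0}^{n-1}\frac{(k+1)^2}{(n-k)^2(n+k+2)^2}\cdot\frac{\left[(k+2-\alpha)_{n-k}-(-1)^{n-k}(k+\alpha+1)_{n-k}\right]^2}{(k+\alpha+1)_{n-k}\,(k+2-\alpha)_{n-k}}+\psi^{(1)}(n+2-\alpha)+\psi^{(1)}(n+\alpha+1).$$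
   Context: The Grosjean polynomials of the second kind are the monic Jacobi polynomials with $\alpha+\beta=1$: $g_n^{(\alpha)}(x)=e_nP_n^{(\alpha,1-\alpha)}(x)$ with $e_n=2^n\binom{2n+1}{n}^{-1}$ and $-1<\alpha<2$. They are orthogonal on $(-1,1)$ with respect to $\omega_g(x;\alpha)=\left(\frac{1-x}{1+x}\right)^\alpha(1+x)=(1-x)^\alpha(1+x)^{1-\alpha}$, and $\tilde g_n^{(\alpha)}=g_n^{(\alpha)}/d_n$ with $d_n>0$, $d_n^2=\int_{-1}^1[g_n^{(\alpha)}]^2\omega_g\,dx$. $(x)_m$ is the Pochhammer symbol and $\psi^{(1)}(x)=\frac{d^2}{dx^2}\ln\Gamma(x)$ is the trigamma function. *)

(* Defs.v *)
From mathcomp Require Import all_boot all_order all_algebra.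
From mathcomp Require Import all_classical all_reals all_analysis.

Set Implicit Arguments.
Unset Strict Implicit.
Unset Printing Implicit Defensive.

Import Order.TTheory GRing.Theory Num.Theory.
Import numFieldNormedType.Exports.

Local Open Scope classical_set_scope.
Local Open Scope ring_scope.

Section Grosjean.
Variable R : realType.
Implicit Types (a b t x : R) (n m : nat).

Definition pochhammer x m : R := \prod_(i < m) (x + i%:R).

(* Euler's integral; it converges for 0 < t, the only range that is used. *)
Definition Gamma t : R :=
  \int[lebesgue_measure]_(u in `]0, +oo[) (u `^ (t - 1) * expR (- u)).

Definition trigamma : R -> R := derive1n 2 (fun t => ln (Gamma t)).

(* P_n^(a,b) = (a+1)_n / n! 2F1(-n, n+a+b+1; a+1; (1-x)/2), where the factors
   (a+1)_l are cancelled between (a+1)_n and the denominators of the series: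
   P_n^(a,b) = \sum_(l <= n) (n+a+b+1)_l (a+l+1)_(n-l) / (l! (n-l)!)
                             ((x-1)/2)^l. *)
Definition jacobi n a b : {poly R} :=
  \sum_(l < n.+1)
    (pochhammer (n%:R + a + b + 1) l * pochhammer (a + l%:R + 1) (n - l)
       / (l`! * (n - l)`!)%:R) *: (2^-1 *: ('X - 1)) ^+ l.

(* The scalar is the inverse of the leading coefficient
   2^-n 'C(2n+a+b, n) of jacobi n a b when a + b = 1. *)
Definition grosjean2 n a : {poly R} :=
  (2 ^+ n / 'C(2 * n + 1, n)%:R) *: jacobi n a (1 - a).

Definition grosjean2_weight a x : R := ((1 - x) / (1 + x)) `^ a * (1 + x).

Definition grosjean2_norm n a : R :=
  Num.sqrt (\int[lebesgue_measure]_(x in `]-1, 1[)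
              ((grosjean2 n a).[x] ^+ 2 * grosjean2_weight a x)).

Definition orthonormal_grosjean2 n a : {poly R} :=
  (grosjean2_norm n a)^-1 *: grosjean2 n a.

(* The integral of a nonnegative function is extended-real valued, so that
   a finite value for it includes the convergence of the integral. *)
Definition grosjean2_fisher n a : \bar R :=
  (4%:E * \int[lebesgue_measure]_(x in `](-1)%R, 1%R[)
    ((derive1 (fun s => Num.sqrt (grosjean2_weight s x)
                * (orthonormal_grosjean2 n s).[x]) a) ^+ 2)%:E)%E.

End Grosjean.

(* Main.v *)
Require Import Defs.
From mathcomp Require Import all_boot all_order all_algebra.
From mathcomp Require Import all_classical all_reals all_analysis.
From mathcomp Require Import measurable_realfun.
From mathcomp Require Import ring lra zify.

(** The weight is [(1 + x) * exp (s * L x)] with [L x = ln ((1 - x) / (1 + x))],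
    so differentiating in the parameter [s] multiplies by [L].  Let [g] be the
    monic polynomial of degree [n], [dg] its derivative in [s], [g'] its
    derivative in [x], and [h] its squared norm.  Since [dg] has degree less
    than [n], it is orthogonal to [g], and differentiating [<g, q> = 0] shows
    that the integral of [L * g * dg] is [- |dg|^2].  Expanding the square gives
      [I = h'' / h - (h' / h)^2 + 2 |dg|^2 / h].
    Up to a constant, [h] is [Gamma (n + 1 + s) * Gamma (n + 2 - s)] (Euler's
    Beta integral), so the first two terms are the trigamma values.
    Differentiating the Jacobi equation in [s] gives
      [(n - k) (n + k + 2) <dg, g_k> = 2 <g', g_k>].
    For [p] of degree at most [n], integration by parts reduces [<g', p>] to
    the values of [p] at [1] and [-1], and the two coefficients are found from
    [p = g_n] and [p = g_(n+1)].  Parseval's identity then produces the finite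
    sum. *)

Set Implicit Arguments.
Unset Strict Implicit.
Unset Printing Implicit Defensive.

Import Order.TTheory GRing.Theory Num.Theory.
Import numFieldNormedType.Exports.

Local Open Scope classical_set_scope.
Local Open Scope ring_scope.

(** * Jacobi operator *)

(** The constraint [a + b = 1] keeps the parameter out of both the eigenvalue [- n (n + 2)] and the
    leading coefficient of the Jacobi polynomial. This is why differentiating the equation of the
    monic polynomial adds only the term [- 2 g'].

    The algebra is done for an abstract linear functional [l] on polynomials that vanishes on the
    image of [pearson] and is positive at [1]; integration against the weight is substituted for it
    only at the end. Norms and pairings with [g'] come out of one induction, each norm fixing the
    boundary coefficients of the next pairing.

    The dependence of the norm on the parameter is read off at [(1 - x^2)^n] rather than at [1]: the
    Beta integral there has the arguments [n + 1 + s] and [n + 2 - s] themselves, both positive on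
    the whole range.

    On the analytic side every integral is improper. Compact segments carry the fundamental theorem
    and substitution over to open intervals, and a single result on integrals of [h exp (s phi)]
    yields the derivatives of Gamma and of the moments of the weight alike. *)

Section Pochhammer.
Variable R : realType.
Implicit Types (x : R) (m n k : nat).

Lemma pochhammer0 x : pochhammer x 0 = 1.
Proof. by rewrite /pochhammer big_ord0. Qed.

Lemma pochhammerS x m : pochhammer x m.+1 = pochhammer x m * (x + m%:R).
Proof. by rewrite /pochhammer big_ord_recr. Qed.

Lemma pochhammerSl x m : pochhammer x m.+1 = x * pochhammer (x + 1) m.
Proof.
rewrite /pochhammer big_ord_recl addr0; congr (_ * _).
by apply: eq_bigr => i _; rewrite -addrA -natr1 [_ + 1]addrC.
Qed.

Lemma pochhammerD x m k :
  pochhammer x (m + k) = pochhammer x m * pochhammer (x + m%:R) k.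
Proof.
elim: k => [|k IH]; first by rewrite addn0 pochhammer0 mulr1.
by rewrite addnS !pochhammerS IH natrD addrA mulrA.
Qed.

Lemma pochhammer_gt0 x m : 0 < x -> 0 < pochhammer x m.
Proof. by move=> x0; apply: prodr_gt0 => i _; rewrite ltr_wpDr. Qed.

Lemma pochhammer_nat k m : k`!%:R * pochhammer (k.+1%:R : R) m = (k + m)`!%:R.
Proof.
elim: m => [|m IH]; first by rewrite pochhammer0 mulr1 addn0.
by rewrite pochhammerS mulrA IH addnS factS -natrD -natrM mulnC addSn.
Qed.

End Pochhammer.

Section JacobiOperator.
Variable R : realType.
Implicit Types (a b x : R) (p q : {poly R}) (n m k : nat).

Let coef_deriv_nat p i : p^`()`_i = i.+1%:R * p`_i.+1.
Proof. by rewrite coef_deriv mulr_natl. Qed.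

(* [pearson a p * w = ((1 - x^2) p w)'] for the weight [w] of parameter [a];
   [pearson a p^`()] is the Jacobi differential operator applied to [p]. *)
Definition pearson a p : {poly R} :=
  (1 - 'X^2) * p^`() + ((1 - 2 * a)%:P - 3%:P * 'X) * p.

Lemma pearsonD a p q : pearson a (p + q) = pearson a p + pearson a q.
Proof. by rewrite /pearson derivD !mulrDr addrACA. Qed.

Lemma pearsonZ a c p : pearson a (c *: p) = c *: pearson a p.
Proof. by rewrite /pearson derivZ -!scalerAr scalerDr. Qed.

Lemma pearsonM a p q :
  pearson a (p * q) = pearson a p * q + (1 - 'X^2) * p * q^`().
Proof. rewrite /pearson derivM; ring. Qed.

Lemma coef_pearson a p i : (pearson a p)`_i =
  i.+1%:R * p`_i.+1 + (1 - 2 * a) * p`_i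
  - (i%:R + 2) * (if i is j.+1 then p`_j else 0).
Proof.
have -> : pearson a p = p^`() - 'X^2 * p^`() + (1 - 2 * a) *: p - 3 *: ('X * p).
  by rewrite /pearson -!mul_polyC; ring.
rewrite !coefB !coefD !coefZ ?coefN ?coefXM ?coefXnM ?coef_deriv_nat.
case: i => [|[|i]] /=; rewrite ?subn2 /= ?coef_deriv_nat.
- by ring.
- by ring.
- by rewrite -!natr1; ring.
Qed.

Lemma size_pearson a p n : (size p <= n)%N -> (size (pearson a p) <= n.+1)%N.
Proof.
move=> sp; apply/leq_sizeP => -[//|j] nj.
have p0 i : (n <= i)%N -> p`_i = 0 by move=> ni; rewrite nth_default // (leq_trans sp).
by rewrite coef_pearson !p0 ?(mulr0, subr0, addr0) //; lia.
Qed.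

(** Coefficient of [((X - 1)/2)^l] once [a + b = 1]; of its two Pochhammer symbols only the second
    still depends on [a]. *)
Definition jacobi_coef n a l : R :=
  pochhammer (n%:R + 2) l * pochhammer (a + l%:R + 1) (n - l)
       / (l`! * (n - l)`!)%:R.

Let z : {poly R} := 2^-1 *: ('X - 1).

Let dz : z^`() = (2^-1)%:P.
Proof. by rewrite /z derivZ derivB derivX derivC subr0 -alg_polyC. Qed.

Let size_z : size z = 2%N.
Proof. by rewrite /z size_scale ?invr_eq0 ?pnatr_eq0 // -polyC1 size_XsubC. Qed.

Let lead_z : lead_coef z = 2^-1.
Proof. by rewrite /z lead_coefZ -polyC1 lead_coefXsubC mulr1. Qed.

Let jacobi_comp n a :
  jacobi n a (1 - a) = (\poly_(l < n.+1) jacobi_coef n a l) \Po z.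
Proof.
rewrite /jacobi poly_def raddf_sum /=; apply: eq_bigr => l _.
rewrite comp_polyZ rmorphXn /= comp_polyX /jacobi_coef; congr (_ *: _).
by congr (pochhammer _ _ * _ / _); ring.
Qed.

(** Term ratio of the hypergeometric series. The default [0] at [l = n] encodes its termination,
    where the right-hand factor vanishes as well. *)
Lemma jacobi_coefS n a l : (l <= n)%N ->
  (l%:R + 1) * (l%:R + a + 1) * (if (l < n)%N then jacobi_coef n a l.+1 else 0)
  = (n%:R * (n%:R + 2) - l%:R * (l%:R + 2)) * jacobi_coef n a l.
Proof.
rewrite leq_eqVlt => /predU1P[->|ln]; first by rewrite ltnn mulr0 subrr mul0r.
rewrite ln /jacobi_coef pochhammerS.
have -> : (n - l)%N = (n - l.+1).+1 by lia.
rewrite pochhammerSl [in (l.+1)`!]factS [in (_.+1)`!]factS !natrM.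
have -> : a + l.+1%:R + 1 = a + l%:R + 1 + 1 by rewrite -natr1; ring.
have -> : n%:R = (n - l.+1)%:R + l%:R + 1 :> R.
  by rewrite -[X in _ + X]/(1%:R) -!natrD; congr (_%:R); lia.
have fl : l`!%:R != 0 :> R by rewrite pnatr_eq0 -lt0n fact_gt0.
have fm : (n - l.+1)`!%:R != 0 :> R by rewrite pnatr_eq0 -lt0n fact_gt0.
have gl : (l%:R + 1) != 0 :> R by rewrite natr1 pnatr_eq0.
have gm : ((n - l.+1)%:R + 1) != 0 :> R by rewrite natr1 pnatr_eq0.
rewrite -!natr1; by field; rewrite fl fm /= ?gl ?gm.
Qed.

Lemma jacobi_ode n a :
  pearson a (jacobi n a (1 - a))^`() = - (n%:R * (n%:R + 2)) *: jacobi n a (1 - a).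
Proof.
rewrite jacobi_comp; set G := \poly_(l < _) _.
have Xz : 'X = 1 + 2 *: z by rewrite /z scalerA divff ?pnatr_eq0 // scale1r addrC subrK.
have dG : (G \Po z)^`() = 2^-1 *: (G^`() \Po z).
  by rewrite deriv_comp dz mulrC mul_polyC.
have ddG : (G \Po z)^`()^`() = 4^-1 *: (G^`()^`() \Po z).
  rewrite dG derivZ deriv_comp dz [_ * _%:P]mulrC mul_polyC scalerA.
  by congr (_ *: _); field.
(* The equation in the variable [z = (X - 1)/2], where [1 - X^2 = - 4 z (1 + z)]; coefficient by
   coefficient it is [jacobi_coefS]. *)
have ode : - ('X * (1 + 'X)) * G^`()^`() - ((a + 1)%:P + 3%:P * 'X) * G^`()
    = - (n%:R * (n%:R + 2)) *: G.
  apply/polyP => i.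
  have -> : - ('X * (1 + 'X)) * G^`()^`() - ((a + 1)%:P + 3%:P * 'X) * G^`() =
     - ('X * G^`()^`()) - 'X^2 * G^`()^`() - (a + 1) *: G^`() - 3 *: ('X * G^`()).
    by rewrite -!mul_polyC; ring.
  rewrite !(coefB, coefN, coefZ, coefXM) coefXnM.
  have E j : G`_j = if (j < n.+1)%N then jacobi_coef n a j else 0 by rewrite coef_poly.
  have [ni|ni] := ltnP n i.
    have Z j : (n < j)%N -> G`_j = 0 by move=> nj; rewrite E ifF //; lia.
    case: i ni => [//|[|i]] ni; rewrite ?subn2 /= !coef_deriv_nat !Z; try lia; ring.
  have J := jacobi_coefS a ni.
  case: i ni J => [|[|i]] ni J; rewrite ?subn2 /= !coef_deriv_nat !E !ltnS ni.
  - by move: J; rewrite !mul0r => J; lra.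
  - by move: J => J; lra.
  - by move: J; rewrite -!natr1 => J; nra.
rewrite -[RHS]comp_polyZ -ode comp_polyB mulNr raddfN /=.
rewrite (comp_polyM _ G^`()^`()) comp_polyM comp_polyX (comp_polyM _ G^`()).
rewrite comp_polyD -polyC1 comp_polyC comp_polyX comp_polyD comp_polyM.
rewrite comp_polyC (comp_polyC 3) comp_polyX.
rewrite /pearson ddG dG.
move: (_ \Po _) (G^`() \Po _) => q2 q1.
rewrite Xz polyC1 -!mul_polyC.
set r2 := _ * q2; set r1 := _ * q1.
have -> : q2 = 4 * r2.
  by rewrite /r2 mulrA -(polyC_natr _ 4) -polyCM divff ?pnatr_eq0 // mul1r.
have -> : q1 = 2 * r1.
  by rewrite /r1 mulrA -(polyC_natr _ 2) -polyCM divff ?pnatr_eq0 // mul1r.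
rewrite !polyCD polyCN polyCM polyC1 !polyC_natr; ring.
Qed.

Lemma size_jacobi n a : size (jacobi n a (1 - a)) = n.+1.
Proof.
rewrite jacobi_comp size_comp_poly2 // size_poly_eq //= /jacobi_coef subnn.
rewrite pochhammer0 mulr1 mulf_neq0 ?invr_eq0 ?pnatr_eq0 -?lt0n ?muln_gt0 ?fact_gt0 //.
by rewrite gt_eqF // pochhammer_gt0 // -natrD ltr0n addn2.
Qed.

(** The number [e_n / n!], the factor free of [a] that the values of the monic polynomial at [1] and
    [-1] share up to sign. *)
Definition grosjean2_scale n : R := 2 ^+ n / 'C(2 * n + 1, n)%:R / n`!%:R.

Lemma grosjean2_scale_gt0 n : 0 < grosjean2_scale n.
Proof.
rewrite /grosjean2_scale !divr_gt0 ?exprn_gt0 ?ltr0n ?fact_gt0 ?bin_gt0 //; lia.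
Qed.

Lemma grosjean2_scaleE n :
  grosjean2_scale n = 2 ^+ n * (n.+1)`!%:R / ((2 * n).+1)`!%:R.
Proof.
have /(congr1 (fun k : nat => k%:R : R)) : ('C(2 * n + 1, n) * (n`! * (n.+1)`!) = ((2 * n).+1)`!)%N.
  rewrite -[in RHS]addn1 -(@bin_fact (2 * n + 1) n) //; last by lia.
  by congr (_ * (_ * _`!))%N; lia.
rewrite /grosjean2_scale => E; rewrite natrM (natrM _ n`!) in E.
have c0 : 'C(2 * n + 1, n)%:R != 0 :> R by rewrite pnatr_eq0 -lt0n bin_gt0; lia.
have f0 k : k`!%:R != 0 :> R by rewrite pnatr_eq0 -lt0n fact_gt0.
by rewrite -E; field; rewrite c0 !f0.
Qed.

Lemma grosjean2_scaleS n : grosjean2_scale n.+1 * ((n%:R + 1) * (2 * n%:R + 3))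
   = grosjean2_scale n * (n%:R + 2).
Proof.
rewrite !grosjean2_scaleE.
have -> : (2 * n.+1).+1 = (2 * n).+3 by lia.
rewrite exprS (factS n.+1) (natrM _ n.+2) (factS (2 * n).+2).
rewrite (natrM _ (2 * n).+3) (factS (2 * n).+1) (natrM _ (2 * n).+2).
have f0 : (2 * n).+1`!%:R != 0 :> R by rewrite pnatr_eq0 -lt0n fact_gt0.
have g2 : (2 * n).+2%:R = 2 * (n%:R + 1) :> R by rewrite -natr1 -natr1 natrM; ring.
have g3 : (2 * n).+3%:R = 2 * n%:R + 3 :> R by rewrite -natr1 g2; ring.
have h2 : n%:R + 1 != 0 :> R by rewrite natr1 pnatr_eq0.
have h3 : 2 * n%:R + 3 != 0 :> R by rewrite -g3 pnatr_eq0.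
have -> : n.+2%:R = n%:R + 2 :> R by rewrite -natrD addn2.
rewrite g2 g3; by field; rewrite f0 h2 h3.
Qed.

Lemma grosjean2_ode n a :
  pearson a (grosjean2 n a)^`() = - (n%:R * (n%:R + 2)) *: grosjean2 n a.
Proof. by rewrite /grosjean2 derivZ pearsonZ jacobi_ode !scalerA mulrC. Qed.

Let scale_neq0 n : 2 ^+ n / 'C(2 * n + 1, n)%:R != 0 :> R.
Proof. by rewrite mulf_neq0 ?expf_neq0 ?invr_eq0 ?pnatr_eq0 // -lt0n bin_gt0; lia. Qed.

Lemma size_grosjean2 n a : size (grosjean2 n a) = n.+1.
Proof. by rewrite /grosjean2 size_scale ?size_jacobi. Qed.

(** The leading coefficient of [jacobi] is [2^-n (n + 2)_n / n!], and
    [(n + 2)_n = (2n + 1)! / (n + 1)!] turns it into [2^-n] times the binomial coefficient of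
    [2n + 1] over [n]. *)
Lemma grosjean2_monic n a : grosjean2 n a \is monic.
Proof.
rewrite monicE /grosjean2 lead_coefZ jacobi_comp lead_coef_comp ?size_z // lead_z.
have J : jacobi_coef n a n = pochhammer (n%:R + 2) n / n`!%:R.
  by rewrite /jacobi_coef subnn pochhammer0 mulr1 fact0 muln1.
have Jn : jacobi_coef n a n != 0.
  rewrite J mulf_neq0 ?invr_eq0 ?pnatr_eq0 -?lt0n ?fact_gt0 //.
  by rewrite gt_eqF // pochhammer_gt0 // -natrD ltr0n addn2.
rewrite lead_coef_poly // size_poly_eq //= J exprVn.
have := pochhammer_nat R n.+1 n.
have -> : n.+2%:R = n%:R + 2 :> R by rewrite -natrD addn2.
have -> : (n.+1 + n = (2 * n).+1)%N by lia.
have := grosjean2_scaleE n; rewrite /grosjean2_scale.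
have f0 k : k`!%:R != 0 :> R by rewrite pnatr_eq0 -lt0n fact_gt0.
move=> E F; have -> : pochhammer (n%:R + 2) n = (2 * n).+1`!%:R / n.+1`!%:R :> R.
  by rewrite -F mulrC mulKf.
apply/eqP; move: E; set A := _ / _%:R / n`!%:R => E.
rewrite [LHS](_ : _ = A * (2 * n).+1`!%:R / n.+1`!%:R / 2 ^+ n); last by rewrite /A; ring.
rewrite E; by field; rewrite !f0 /= expf_neq0 ?pnatr_eq0.
Qed.

Lemma grosjean2_at1 n a : (grosjean2 n a).[1] = grosjean2_scale n * pochhammer (a + 1) n.
Proof.
rewrite /grosjean2 hornerZ jacobi_comp horner_comp /z hornerZ !hornerE subrr mulr0.
rewrite horner_poly big_ord_recl /= expr0 mulr1 big1 ?addr0; last first.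
  by move=> i _; rewrite exprS mul0r mulr0.
by rewrite /jacobi_coef pochhammer0 addr0 subn0 fact0 !mul1n mul1r /grosjean2_scale; ring.
Qed.

End JacobiOperator.

(** * Reflection symmetry and the value at -1 *)

Section Reflection.
Variable R : realType.
Implicit Types (a : R) (p q : {poly R}) (n : nat).

(** Comparing leading coefficients, an eigenfunction of degree [m] has eigenvalue [- m (m + 2)], and
    [m (m + 2)] is strictly increasing in [m]. *)
Lemma jacobi_eigen_lt_eq0 a n p : (size p <= n)%N ->
  pearson a p^`() = - (n%:R * (n%:R + 2)) *: p -> p = 0.
Proof.
move=> sp ode; apply/eqP; rewrite -lead_coef_eq0 -[_ == _]negbK; apply/negP => lp.
have p0 : p != 0 by rewrite -lead_coef_eq0.
have Sm : size p = (size p).-1.+1 by rewrite prednK // size_poly_gt0.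
move: ode => /(congr1 (fun q : {poly R} => q`_(size p).-1)).
rewrite coef_pearson coefZ !coef_deriv -Sm -lead_coefE !nth_default ?leqnn ?leqnSn //.
rewrite !mul0rn !mulr0 !add0r.
have mn : (((size p).-1)%:R : R) < n%:R by rewrite ltr_nat; lia.
have -> : (if (size p).-1 is j.+1 then p^`()`_j else 0) = (size p).-1%:R * lead_coef p.
  rewrite lead_coefE; case: (size p).-1 => [|j]; first by rewrite mul0r.
  by rewrite coef_deriv mulr_natl.
have m0 : 0 <= ((size p).-1%:R : R) by [].
move: (size p).-1%:R mn m0 => m mn m0 Em.
have /eqP : (m * (m + 2) - n%:R * (n%:R + 2)) * lead_coef p = 0 by lra.
by rewrite mulf_eq0 (negbTE lp) orbF => /eqP; nra.
Qed.

(** The substitution of [- x] for [x] exchanges the exponents [a] and [1 - a] of the weight, hence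
    the two Jacobi operators. *)
Lemma pearson_comp_opp a p :
  pearson a (p \Po (- 'X))^`() = pearson (1 - a) p^`() \Po (- 'X).
Proof.
have d q : (q \Po (- 'X))^`() = - (q^`() \Po (- 'X)).
  by rewrite deriv_comp derivN derivX mulrN1.
rewrite /pearson d derivN d opprK comp_polyD !comp_polyM !comp_polyB comp_polyM.
rewrite -polyC1 !comp_polyC !comp_polyX.
by rewrite comp_polyM comp_polyC comp_polyX !(polyCB, polyCM, polyC1, polyC_natr); ring.
Qed.

(* Both sides are monic of degree [n] and satisfy the same differential
   equation, so their difference is an eigenfunction of too small a degree. *)
Lemma grosjean2_reflection n a :
  grosjean2 n a = (-1) ^+ n *: (grosjean2 n (1 - a) \Po (- 'X)).
Proof.
have sX : size (- 'X : {poly R}) = 2%N by rewrite size_polyN size_polyX.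
apply/eqP; rewrite -subr_eq0; apply/eqP.
set q := _ *: _; set d := _ - _.
have Eq : pearson a q^`() = - (n%:R * (n%:R + 2)) *: q.
  rewrite /q derivZ pearsonZ pearson_comp_opp grosjean2_ode comp_polyZ.
  by rewrite !scalerA mulrC.
apply: (@jacobi_eigen_lt_eq0 a n); last first.
  by rewrite /d derivB -scaleN1r pearsonD pearsonZ grosjean2_ode Eq scaleN1r scalerBr.
have sq : size q = n.+1.
  by rewrite /q size_scale ?signr_eq0 // size_comp_poly2 // size_grosjean2.
have lq : lead_coef q = 1.
  rewrite /q lead_coefZ lead_coef_comp ?sX // (monicP (grosjean2_monic _ _)).
  by rewrite size_grosjean2 lead_coefN lead_coefX mul1r /= -expr2 sqrr_sign.
apply/leq_sizeP => j; rewrite leq_eqVlt => /predU1P[<-|nj].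
  have top p : size p = n.+1 -> p`_n = lead_coef p by rewrite lead_coefE => ->.
  by rewrite coefB !top ?size_grosjean2 // lq (monicP (grosjean2_monic _ _)) subrr.
by rewrite coefB !nth_default ?subr0 ?sq ?size_grosjean2.
Qed.

Lemma grosjean2_atN1 n a :
  (grosjean2 n a).[-1] = (-1) ^+ n * (grosjean2_scale R n * pochhammer (2 - a) n).
Proof.
rewrite grosjean2_reflection hornerZ horner_comp hornerN hornerX opprK grosjean2_at1.
by congr (_ * (_ * pochhammer _ _)); ring.
Qed.

End Reflection.

(** The part free of the parameter in the quotient of [l ((1 - 'X^2) ^+ n)] by [l 1]; its factors
    are those of the recurrence [functional_1mX2S]. *)
Definition beta_ratio {R : realType} n : R :=
  \prod_(i < n) (2 / ((2 * i%:R + 3) * (i%:R + 2))).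

Lemma beta_ratio_gt0 {R : realType} n : 0 < beta_ratio n :> R.
Proof.
by apply: prodr_gt0 => i _; rewrite divr_gt0 // mulr_gt0.
Qed.

(** * Norms and pairings for a functional satisfying the Pearson relation *)

Section JacobiFunctional.
Variables (R : realType) (a : R) (l : {poly R} -> R).
Hypothesis lD : forall p q, l (p + q) = l p + l q.
Hypothesis lZ : forall c p, l (c *: p) = c * l p.
Hypothesis l_pearson : forall p, l (pearson a p) = 0.
Hypothesis a_gtN1 : -1 < a.
Hypothesis a_lt2 : a < 2.
Hypothesis l1_gt0 : 0 < l 1.

Implicit Types (p q : {poly R}) (n m k : nat).

Local Notation g n := (grosjean2 n a).
Local Notation h n := (l (grosjean2 n a ^+ 2)).
Local Notation E := (grosjean2_scale R).
Local Notation A := (pochhammer (a + 1)).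
Local Notation B := (pochhammer (2 - a)).

Let l0 : l 0 = 0. Proof. by rewrite -(scale0r 0) lZ mul0r. Qed.

Let lN p : l (- p) = - l p.
Proof. by rewrite -scaleN1r lZ mulN1r. Qed.

Let lsum n (F : 'I_n -> {poly R}) : l (\sum_i F i) = \sum_i l (F i).
Proof. exact: (big_morph _ lD l0). Qed.

Let A_gt0 n : 0 < A n. Proof. apply: pochhammer_gt0; move: a_gtN1 a_lt2; lra. Qed.
Let B_gt0 n : 0 < B n. Proof. apply: pochhammer_gt0; move: a_gtN1 a_lt2; lra. Qed.
Let E_gt0 n : 0 < E n. Proof. exact: grosjean2_scale_gt0. Qed.

(** Integration by parts: the factor [1 - 'X^2] removes the boundary terms, so it is the product
    rule [pearsonM] under [l]. *)
Lemma functional_deriv p q : l (q^`() * ((1 - 'X^2) * p)) = - l (pearson a p * q).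
Proof.
by apply/eqP; rewrite -addr_eq0 -lD addrC [_^`() * _]mulrC -pearsonM l_pearson.
Qed.

Lemma jacobi_op_sym p q : l (pearson a p^`() * q) = l (p * pearson a q^`()).
Proof.
have S u v : l (pearson a u^`() * v) = - l ((1 - 'X^2) * u^`() * v^`()).
  by rewrite -[LHS]opprK -functional_deriv [_^`() * _]mulrC.
by rewrite [p * _]mulrC !S -!mulrA [p^`() * _]mulrC.
Qed.

(** Eigenfunctions of a symmetric operator; the eigenvalues differ by [(m - n) (m + n + 2)] up to
    sign, which is nonzero. *)
Lemma grosjean2_orthogonal_neq m n : m != n -> l (g m * g n) = 0.
Proof.
move=> mn; have := jacobi_op_sym (g m) (g n).
move: (g m) (g n) (grosjean2_ode m a) (grosjean2_ode n a) => u v -> ->.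
rewrite -scalerAl -scalerAr !lZ => /eqP.
rewrite -subr_eq0 -mulrBl mulf_eq0 => /orP[/eqP Ev|/eqP //].
have : (m%:R - n%:R) * (m%:R + n%:R + 2) = 0 :> R by rewrite -[RHS]oppr0 -Ev; ring.
move/eqP; rewrite mulf_eq0 subr_eq0 eqr_nat (negbTE mn) /= => /eqP.
by rewrite -!natrD => /eqP; rewrite pnatr_eq0 addn2.
Qed.

Let coef_g n : (g n)`_n = 1.
Proof.
by rewrite -{2}[n]/(n.+1.-1) -(size_grosjean2 n a) -lead_coefE (monicP (grosjean2_monic _ _)).
Qed.

Let coef_g_gt n j : (n < j)%N -> (g n)`_j = 0.
Proof. by move=> nj; rewrite nth_default ?size_grosjean2. Qed.

Lemma grosjean2_span n q : (size q <= n)%N ->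
  exists c : nat -> R, q = \sum_(k < n) c k *: g k.
Proof.
elim: n q => [|n IH] q sq.
  by exists (fun=> 0); rewrite big_ord0; apply/eqP; rewrite -size_poly_leq0.
have [|c Ec] := IH (q - q`_n *: g n).
  apply/leq_sizeP => j; rewrite leq_eqVlt => /predU1P[<-|nj].
    by rewrite coefB coefZ coef_g mulr1 subrr.
  by rewrite coefB coefZ coef_g_gt // mulr0 subr0 nth_default // (leq_trans sq).
exists (fun k => if k == n then q`_n else c k).
rewrite big_ord_recr /= eqxx -[LHS](subrK (q`_n *: g n)) Ec; congr (_ + _).
by apply: eq_bigr => i _; rewrite ltn_eqF.
Qed.

Lemma grosjean2_orthogonal n q : (size q <= n)%N -> l (g n * q) = 0.
Proof.
move=> /grosjean2_span[c ->]; rewrite mulr_sumr lsum big1 // => i _.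
by rewrite -scalerAr lZ grosjean2_orthogonal_neq ?mulr0 // gtn_eqF.
Qed.

Lemma grosjean2_pairing n q : (size q <= n.+1)%N -> l (g n * q) = q`_n * h n.
Proof.
move=> sq; rewrite -[q in LHS](subrK (q`_n *: g n)) mulrDr lD.
rewrite grosjean2_orthogonal ?add0r; first by rewrite -scalerAr lZ.
apply/leq_sizeP => j; rewrite leq_eqVlt => /predU1P[<-|nj].
  by rewrite coefB coefZ coef_g mulr1 subrr.
by rewrite coefB coefZ coef_g_gt // mulr0 subr0 nth_default // (leq_trans sq).
Qed.

Lemma interpolation_pm1 p : exists r : {poly R},
  p = (p.[1] / 2) *: (1 + 'X) + (p.[-1] / 2) *: (1 - 'X) + (1 - 'X^2) * r.
Proof.
set L := (_ *: _ + _ *: _).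
have /factor_theorem[q Eq] : root (p - L) 1.
  by rewrite rootE /L !hornerE subrr mulr0 addr0; apply/eqP; field.
have q0 : root q (-1).
  have : (p - L).[-1] = 0 by rewrite /L !hornerE; field.
  rewrite Eq hornerM hornerXsubC => /eqP; rewrite mulf_eq0 => /orP[//|].
  by rewrite -opprD oppr_eq0 -[1 + 1]/(2%:R) pnatr_eq0.
have /factor_theorem[r Er] := q0.
exists (- r); apply/eqP; rewrite addrC -subr_eq Eq Er polyCN polyC1.
by apply/eqP; ring.
Qed.

Lemma size_grosjean2_deriv n : (size (g n)^`() <= n)%N.
Proof. apply/leq_sizeP => j nj; rewrite coef_deriv coef_g_gt ?mul0rn //. Qed.

(* Write [p] as its interpolant at [1] and [-1] plus [(1 - 'X^2) * r], and
   integrate the second part by parts.  The proportion between the two boundary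
   coefficients comes from [p = g n], for which the left-hand side vanishes. *)
Lemma grosjean2_deriv_pairing n : (0 < n)%N -> exists kappa : R,
  forall p, (size p <= n.+2)%N -> l ((g n)^`() * p) =
    kappa * (p.[1] * (g n).[-1] - p.[-1] * (g n).[1]) - (n%:R + 2) * p`_n.+1 * h n.
Proof.
move=> n0.
pose U := l ((g n)^`() * (1 + 'X)) / 2; pose V := l ((g n)^`() * (1 - 'X)) / 2.
have UV p : (size p <= n.+2)%N ->
    l ((g n)^`() * p) = p.[1] * U + p.[-1] * V - (n%:R + 2) * p`_n.+1 * h n.
  move=> sp; have [r Er] := interpolation_pm1 p.
  have sr : (size r <= n)%N.
    have [->|r0] := eqVneq r 0; first by rewrite size_poly0.
    have Es : size ((1 - 'X^2) * r) = (size r).+2.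
      have s2 : size (1 - 'X^2 : {poly R}) = 3%N.
        by rewrite -size_polyN opprB -polyC1 size_XnsubC.
      by rewrite size_mul // ?s2 // -size_poly_gt0 s2.
    rewrite -2!ltnS -Es.
    rewrite -[(1 - 'X^2) * r](addKr ((p.[1] / 2) *: (1 + 'X) + (p.[-1] / 2) *: (1 - 'X))) -Er.
    apply/leq_sizeP => j nj.
    rewrite coefD coefN coefD !coefZ !coefD !coefN !coef1 !coefX nth_default ?(leq_trans sp) //.
    by case: j nj => [|[|j]] //= _; ring.
  have rj j : (n <= j)%N -> r`_j = 0 by move=> nj; rewrite nth_default // (leq_trans sr).
  (* The interpolant has degree at most [1] and [n] is positive, so the coefficient of degree
     [n + 1] comes from [- X^2 r] alone. *)
  have rn : p`_n.+1 = - r`_n.-1.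
    rewrite Er !(coefD, coefZ, coefN, mulrBl, coefX, coef1, mul1r) coefXnM.
    by case: n n0 {U V sp sr} rj => // n _ rj; rewrite rj //= subn2 /=; ring.
  (* By parts, the last term becomes [- l (pearson a r * g n)], which sees only the coefficient of
     degree [n] of [pearson a r], namely [- (n + 2) r_(n-1)]. *)
  rewrite [in LHS]Er !mulrDr !lD -!(scalerAr _ (g n)^`()) !lZ functional_deriv [pearson _ _ * _]mulrC.
  rewrite grosjean2_pairing ?size_pearson // coef_pearson !rj //.
  rewrite /U /V rn; case: n n0 {U V sp sr rn rj} => // n _ /=; ring.
have g1 : (g n).[1] != 0.
  by rewrite grosjean2_at1 mulf_neq0 // lt0r_neq0.
have := UV (g n); rewrite mulrC grosjean2_orthogonal ?size_grosjean2_deriv // size_grosjean2.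
move=> /(_ (leqnSn _)); rewrite (nth_default _ (_ : size (g n) <= n.+1)%N) ?size_grosjean2 //.
rewrite mulr0 mul0r subr0 => W.
have UE : U = - V / (g n).[1] * (g n).[-1].
  by rewrite mulrAC; apply: (mulIf g1); rewrite mulfVK //; lra.
exists (- V / (g n).[1]) => p sp; rewrite UV // UE; field; exact: g1.
Qed.

(** The undetermined constant at degree [n + 1] is fixed by the test polynomial [g n]: the
    derivative of the monic [g n.+1] has leading coefficient [n + 1], so the pairing is
    [(n + 1) h n], known by hypothesis. *)
Let deriv_pairing_step n :
  h n * n.+1%:R ^+ 2 = l 1 * (E n ^+ 2 * (A n * B n)) ->
  forall p, (size p <= n.+3)%N -> l ((g n.+1)^`() * p) =
    (-1) ^+ n.+1 * l 1 / n.+2%:R * (p.[1] * (g n.+1).[-1] - p.[-1] * (g n.+1).[1])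
    - (n.+1%:R + 2) * p`_n.+2 * h n.+1.
Proof.
move=> IH; have [kappa K] := grosjean2_deriv_pairing (ltn0Sn n).
have Kn : n.+1%:R * h n = kappa * ((g n).[1] * (g n.+1).[-1] - (g n).[-1] * (g n.+1).[1]).
  have := K (g n); rewrite size_grosjean2 => /(_ (leqW (leqnSn _))).
  rewrite coef_g_gt // mulr0 mul0r subr0 => <-.
  rewrite [_^`() * _]mulrC [RHS]grosjean2_pairing ?size_grosjean2_deriv //.
  by rewrite coef_deriv coef_g.
suff -> : (-1) ^+ n.+1 * l 1 / n.+2%:R = kappa by [].
move: Kn; rewrite !grosjean2_at1 !grosjean2_atN1 !pochhammerS => Kn.
have ES := grosjean2_scaleS R n.
have s2 : (-1) ^+ n * (-1) ^+ n = 1 :> R by rewrite -expr2 sqrr_sign.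
have {Kn} Kn : n.+1%:R * h n = - (-1) ^+ n * kappa * (E n * E n.+1 * (A n * B n) * (2 * n%:R + 3)).
  by rewrite Kn exprS; ring.
have {IH} IH : l 1 * (E n ^+ 2 * (A n * B n)) =
    - (-1) ^+ n * kappa * n.+2%:R * (E n ^+ 2 * (A n * B n)).
  have -> : n.+2%:R = n%:R + 2 :> R by rewrite -natrD addn2.
  rewrite -IH (expr2 n.+1%:R) mulrA [h n * _]mulrC Kn -natr1.
  transitivity (- (-1) ^+ n * kappa * (E n * (A n * B n)) * (E n.+1 * ((n%:R + 1) * (2 * n%:R + 3)))).
    by ring.
  by rewrite ES; ring.
have {IH} -> : l 1 = - (-1) ^+ n * kappa * n.+2%:R.
  by apply: (mulIf _ IH); apply: lt0r_neq0; rewrite mulr_gt0 ?exprn_gt0 // mulr_gt0.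
have n2 : n.+2%:R != 0 :> R by rewrite pnatr_eq0.
rewrite mulrA mulfK // exprS mulN1r mulNr [_ * (- _ * _)]mulrA mulrN.
by rewrite s2 mulN1r opprK.
Qed.

(** Induction through [deriv_pairing_step], tested on [g n.+2]: this is orthogonal to the derivative
    of [g n.+1] and has top coefficient [1], so [h n.+1] is expressed by endpoint values. *)
Lemma grosjean2_sq_norm n :
  h n * n.+1%:R ^+ 2 = l 1 * (E n ^+ 2 * (A n * B n)).
Proof.
elim: n => [|n IH].
  have -> : g 0 = 1 by rewrite [g 0]size1_polyC ?size_grosjean2 // coef_g polyC1.
  rewrite !pochhammer0 /grosjean2_scale fact0 bin0.
  by rewrite !(divr1, expr1n, mulr1, expr0).
have := deriv_pairing_step IH (_ : size (g n.+2) <= n.+3)%N.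
rewrite size_grosjean2 => /(_ (leqnn _)).
rewrite mulrC grosjean2_orthogonal; last by rewrite (leq_trans (size_grosjean2_deriv _)) // leqW.
rewrite coef_g mulr1 !grosjean2_at1 !grosjean2_atN1 => /eqP.
rewrite eq_sym subr_eq0 => /eqP H.
have s2 : (-1) ^+ n * (-1) ^+ n = 1 :> R by rewrite -expr2 sqrr_sign.
have ES := grosjean2_scaleS R n.+1.
have n2 : n.+2%:R != 0 :> R by rewrite pnatr_eq0.
have n3 : n.+1%:R + 2 != 0 :> R by rewrite -natrD pnatr_eq0 addn2.
apply: (mulfI n3); rewrite [LHS]mulrA -H.
rewrite (pochhammerS _ n.+1) (pochhammerS (2 - a) n.+1) !exprS.
transitivity ((-1) ^+ n * (-1) ^+ n * l 1 * E n.+1 * (A n.+1 * B n.+1)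
   * (E n.+2 * ((n.+1%:R + 1) * (2 * n.+1%:R + 3)))); last by rewrite s2 ES; ring.
have E2 : n.+2%:R = n.+1%:R + 1 :> R by rewrite natr1.
by rewrite E2 in n2 *; field.
Qed.

Lemma grosjean2_sq_norm_gt0 n : 0 < h n.
Proof.
rewrite -(pmulr_lgt0 _ (_ : 0 < n.+1%:R ^+ 2)) ?exprn_gt0 // grosjean2_sq_norm.
by rewrite mulr_gt0 // mulr_gt0 ?exprn_gt0 // mulr_gt0.
Qed.

(** For the test polynomial [g k] the top-degree term vanishes. Splitting [A n] and [B n] at [k]
    extracts [A k * B k] from both boundary terms and leaves the bracket of the final formula. *)
Lemma grosjean2_deriv_pairing_lt n k : (k < n)%N ->
  l ((g n)^`() * g k) = l 1 / n.+1%:R * (E k * E n * (A k * B k)) *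
    (pochhammer (k%:R + 2 - a) (n - k)
       - (-1) ^+ (n - k) * pochhammer (k%:R + a + 1) (n - k)).
Proof.
case: n => // n kn.
rewrite (deriv_pairing_step (grosjean2_sq_norm n)) ?size_grosjean2; last by lia.
rewrite coef_g_gt ?(ltn_trans kn) // mulr0 mul0r subr0 !grosjean2_at1 !grosjean2_atN1.
have Dn : n.+1 = (k + (n.+1 - k))%N by rewrite subnKC // ltnW.
have sn : (-1) ^+ n.+1 = (-1) ^+ k * (-1) ^+ (n.+1 - k) :> R by rewrite -exprD -Dn.
rewrite sn [in A n.+1]Dn [in B n.+1]Dn !pochhammerD.
have -> : a + 1 + k%:R = k%:R + a + 1 by ring.
have -> : 2 - a + k%:R = k%:R + 2 - a by ring.
have s1 m : (-1) ^+ m * (-1) ^+ m = 1 :> R by rewrite -expr2 sqrr_sign.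
set s := _ ^+ k; set t := _ ^+ (_ - k); set P := pochhammer (k%:R + 2 - a) _; set Q := pochhammer (k%:R + a + 1) _.
transitivity (l 1 / n.+2%:R * (E k * E n.+1 * (A k * B k)) *
   ((s * s) * (t * t) * P - (s * s) * t * Q)); last by rewrite /s /t !s1 !mul1r.
by rewrite /P /Q; ring.
Qed.

Lemma grosjean2_parseval n q : (size q <= n)%N ->
  l (q ^+ 2) = \sum_(k < n) l (q * g k) ^+ 2 / h k.
Proof.
move=> sq; have [c Ec] := grosjean2_span sq.
have ck (k : 'I_n) : l (q * g k) = c k * h k.
  rewrite Ec mulr_suml lsum (bigD1 k) //= big1 ?addr0; first by rewrite -scalerAl lZ.
  by move=> i ik; rewrite -scalerAl lZ grosjean2_orthogonal_neq ?mulr0.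
rewrite expr2 [q in q * _]Ec mulr_suml lsum; apply: eq_bigr => k _.
rewrite -scalerAl lZ [_ * q]mulrC ck; field.
by rewrite lt0r_neq0 // grosjean2_sq_norm_gt0.
Qed.

(* [dg] plays the role of the derivative of [g n] with respect to [a]; the
   hypothesis on it is the derivative of the differential equation. *)
Lemma grosjean2_param_deriv_sq_norm n (dg : {poly R}) : (size dg <= n)%N ->
  pearson a dg^`() - 2 *: (g n)^`() = - (n%:R * (n%:R + 2)) *: dg ->
  2 * l (dg ^+ 2) / h n = 8 * \sum_(0 <= k < n)
           (k.+1%:R ^+ 2 / ((n - k)%:R ^+ 2 * (n + k + 2)%:R ^+ 2)
            * ((pochhammer (k%:R + 2 - a) (n - k)
                - (-1) ^+ (n - k) * pochhammer (k%:R + a + 1) (n - k)) ^+ 2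
               / (pochhammer (k%:R + a + 1) (n - k)
                  * pochhammer (k%:R + 2 - a) (n - k)))).
Proof.
move=> sdg ode; rewrite (grosjean2_parseval sdg) big_mkord.
rewrite mulrAC mulr_sumr mulr_sumr; apply: eq_bigr => k _.
have kn := ltn_ord k.
(* Moving the symmetric operator onto [g k] leaves the eigenvalue gap [n (n + 2) - k (k + 2) = (n -
   k) (n + k + 2)]. *)
have c : (n - k)%:R * (n + k + 2)%:R * l (dg * g k) = 2 * l ((g n)^`() * g k).
  have : l ((pearson a dg^`() - 2 *: (g n)^`()) * g k) = - (n%:R * (n%:R + 2)) * l (dg * g k).
    by rewrite ode -scalerAl lZ.
  rewrite mulrBl lD lN jacobi_op_sym grosjean2_ode -scalerAl -scalerAr !lZ.
  by rewrite natrB 1?ltnW // !natrD => H; lra.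
have nk0 : (n - k)%:R != 0 :> R by rewrite pnatr_eq0 subn_eq0 -ltnNge.
have nk2 : (n + k + 2)%:R != 0 :> R by rewrite pnatr_eq0 addn2.
have {c} -> : l (dg * g k) = 2 * l ((g n)^`() * g k) / ((n - k)%:R * (n + k + 2)%:R).
  by rewrite -c [RHS]mulrAC mulfV ?mul1r // mulf_neq0.
have hE m : h m = l 1 * (E m ^+ 2 * (A m * B m)) / m.+1%:R ^+ 2.
  by rewrite -grosjean2_sq_norm mulfK // expf_neq0 ?pnatr_eq0.
rewrite grosjean2_deriv_pairing_lt // !hE.
have Dn : n = (k + (n - k))%N by rewrite subnKC // ltnW.
have An : A n = A k * pochhammer (k%:R + a + 1) (n - k).
  by rewrite [in LHS]Dn pochhammerD; congr (_ * pochhammer _ _); ring.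
have Bn : B n = B k * pochhammer (k%:R + 2 - a) (n - k).
  by rewrite [in LHS]Dn pochhammerD; congr (_ * pochhammer _ _); ring.
have := A_gt0 n; have := B_gt0 n; rewrite An Bn.
rewrite !pmulr_rgt0 // => Q0 P0.
have /lt0r_neq0 Ak := A_gt0 k; have /lt0r_neq0 Bk := B_gt0 k.
have /lt0r_neq0 Ek := E_gt0 k; have /lt0r_neq0 En := E_gt0 n.
have /lt0r_neq0 L1 := l1_gt0.
have n1 : n.+1%:R != 0 :> R by rewrite pnatr_eq0.
have k1 : k.+1%:R != 0 :> R by rewrite pnatr_eq0.
move/lt0r_neq0 in P0; move/lt0r_neq0 in Q0.
move: (pochhammer (k%:R + a + 1) _) (pochhammer (k%:R + 2 - a) _) P0 Q0 => P Q P0 Q0.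
move: (A k) (B k) (E k) (E n) (l 1) Ak Bk Ek En L1 => Ak Bk Ek En L Ak0 Bk0 Ek0 En0 L0.
move: (n.+1%:R) (k.+1%:R) (n - k)%:R (n + k + 2)%:R ((-1) ^+ _) n1 k1 nk0 nk2 => N K X Y s N0 K0 X0 Y0.
by field; rewrite P0 Q0 Ak0 Bk0 Ek0 En0 L0 N0 K0 X0 Y0.
Qed.

(** With [W = (1 - 'X^2) ^+ n], the relation [l_pearson] at [W] and at [W * 'X] gives two linear
    equations, from which [l (W * 'X)] is eliminated. *)
Lemma functional_1mX2S n :
  l ((1 - 'X^2) ^+ n.+1) * ((2 * n%:R + 3) * (n%:R + 2)) =
  2 * ((a + 1 + n%:R) * (2 - a + n%:R)) * l ((1 - 'X^2) ^+ n).
Proof.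
set W := (1 - 'X^2) ^+ n.
have PW : pearson a W = (1 - 2 * a) *: W - (2 * n%:R + 3) *: (W * 'X).
  have dW : (1 - 'X^2) * W^`() = - (n%:R * (2 * 'X)) * W.
    rewrite /W deriv_exp derivB derivXn -polyC1 derivC polyC1 sub0r expr1 -(mulr_natl _ n).
    case: {W} n => [|n]; first by rewrite !mulr0n !mul0r mulr0 oppr0 mul0r.
    by rewrite (exprS (1 - 'X^2) n) /= -['X *+ 2]mulr_natl; ring.
  rewrite /pearson dW.
  by rewrite -!mul_polyC !(polyCB, polyCD, polyCM, polyC1, polyC_natr); ring.
have W1 : (1 - 2 * a) * l W = (2 * n%:R + 3) * l (W * 'X).
  by have := l_pearson W; rewrite PW lD lN !lZ; lra.
have := l_pearson (W * 'X); rewrite pearsonM derivX mulr1 PW -exprS.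
have -> : ((1 - 2 * a) *: W - (2 * n%:R + 3) *: (W * 'X)) * 'X + (1 - 'X^2) ^+ n.+1 =
    (1 - 2 * a) *: (W * 'X) - (2 * n%:R + 3) *: W + (2 * n%:R + 4) *: (1 - 'X^2) ^+ n.+1.
  rewrite -!mul_polyC exprS -/W !(polyCB, polyCD, polyCM, polyC1, polyC_natr); ring.
rewrite !lD lN !lZ => W2.
transitivity ((2 * n%:R + 3) * ((2 * n%:R + 4) * l ((1 - 'X^2) ^+ n.+1)) / 2).
  by field.
have -> : (2 * n%:R + 4) * l ((1 - 'X^2) ^+ n.+1) =
    (2 * n%:R + 3) * l W - (1 - 2 * a) * l (W * 'X) by move: W2; lra.
by rewrite mulrBr [X in _ - X]mulrCA -W1; field.
Qed.

Lemma functional_1mX2 n :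
  l ((1 - 'X^2) ^+ n) = beta_ratio n * (A n * B n) * l 1.
Proof.
elim: n => [|n IH]; first by rewrite /beta_ratio big_ord0 !pochhammer0 expr0 !mul1r.
have n3 : 2 * n%:R + 3 != 0 :> R by rewrite -natrM -natrD pnatr_eq0 addnC.
have n2 : n%:R + 2 != 0 :> R by rewrite -natrD pnatr_eq0 addnC.
apply: (mulIf (mulf_neq0 n3 n2)); rewrite functional_1mX2S IH !pochhammerS.
rewrite [in RHS]/beta_ratio big_ord_recr /= -/(beta_ratio n); field.
by rewrite n3 n2.
Qed.

(** Both values of [l] are multiples of [A n * B n * l 1] by constants free of [a], so the whole
    dependence on [a] is carried by one Beta integral. *)
Lemma grosjean2_sq_norm_1mX2 n :
  h n = (E n / n.+1%:R) ^+ 2 / beta_ratio n * l ((1 - 'X^2) ^+ n).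
Proof.
have n1 : n.+1%:R != 0 :> R by rewrite pnatr_eq0.
have b0 := lt0r_neq0 (beta_ratio_gt0 n).
apply: (mulIf (expf_neq0 2 n1)); rewrite grosjean2_sq_norm functional_1mX2.
by move: (n.+1%:R : R) n1 => N n1; field; rewrite b0 n1.
Qed.

End JacobiFunctional.

(** * Exponential families and improper integrals *)

Lemma is_derive_expR_scaled (R : realType) (k c s : R) :
  is_derive s 1 (fun x => k * expR (x * c)) (k * c * expR (s * c)).
Proof.
have D : is_derive s 1 (fun x : R => x * c) c.
  by apply: is_derive_eq; rewrite scaler0 add0r /= /GRing.scale /= mulr1.
have D2 : is_derive s 1 (expR \o (fun x : R => x * c)) (c * expR (s * c)).
  by apply: is_derive_eq; rewrite mulrC.
apply: (@is_derive_eq _ _ _ (k \*: (expR \o (fun x : R => x * c))) _ _ _ _ _).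
by rewrite /GRing.scale /= mulrA.
Qed.

Section ExponentialFamily.
Context d (T : measurableType d) (R : realType).
Variables (mu : {measure set T -> \bar R}) (B : set T).
Hypothesis mB : measurable B.
Variables (h phi : T -> R) (u v : R).
Hypothesis mphi : measurable_fun B phi.
Hypothesis int_h : forall s, u < s -> s < v ->
  mu.-integrable B (EFin \o (fun y => h y * expR (s * phi y))).

Let dominating (p q e : R) y :=
  e^-1 * (`|h y * expR (p * phi y)| + `|h y * expR (q * phi y)|).

Let int_dominating p q e : u < p -> p < v -> u < q -> q < v ->
  mu.-integrable B (EFin \o dominating p q e).
Proof.
move=> up pv uq qv.
rewrite (_ : EFin \o _ = (fun y => e^-1%:E *
  (`|(h y * expR (p * phi y))%:E| + `|(h y * expR (q * phi y))%:E|))%E) //.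
apply: integrableZl => //; apply: integrableD => //.
  exact: (integrable_abse (int_h up pv)).
exact: (integrable_abse (int_h uq qv)).
Qed.

(* [e * |phi| <= exp (e * |phi|)], and [x + e] and [x - e] stay in [[p, q]]. *)
Let dominated (p q e x : R) y : 0 < e -> p + e <= x -> x + e <= q ->
  `|h y * phi y * expR (x * phi y)| <= dominating p q e y.
Proof.
move=> e0 px xq; rewrite /dominating !normrM !(gtr0_norm (expR_gt0 _)).
rewrite -mulrDr mulrCA -mulrA ler_wpM2l // -(ler_pM2l e0) mulrA (mulVKf _ _) ?gt_eqF //.
have [phi0|phi0] := leP 0 (phi y).
  rewrite ger0_norm // (le_trans _ (_ : expR (q * phi y) <= _)) ?lerDr ?expR_ge0 //.
  rewrite (@le_trans _ _ (expR (e * phi y) * expR (x * phi y))) //.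
    by rewrite ler_wpM2r ?expR_ge0 // (le_trans _ (expR_ge1Dx _)) // lerDr.
  by rewrite -expRD ler_expR -mulrDl ler_wpM2r // addrC.
rewrite ltr0_norm // (le_trans _ (_ : expR (p * phi y) <= _)) ?lerDl ?expR_ge0 //.
rewrite (@le_trans _ _ (expR (- e * phi y) * expR (x * phi y))) //.
  rewrite ler_wpM2r ?expR_ge0 // (le_trans _ (expR_ge1Dx _)) // mulrN mulNr lerDr //.
by rewrite -expRD ler_expR -mulrDl; apply: ler_wnM2r; [exact: ltW|lra].
Qed.

(** Room for two steps of size [e] on each side: one lets the parameter vary around [s], the other
    absorbs the factor [phi] in the domination. *)
Lemma exponential_family_margin s : u < s -> s < v -> exists2 e : R,
  0 < e & u < s - 2 * e /\ s + 2 * e < v.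
Proof.
move=> us sv; exists (Num.min (s - u) (v - s) / 3).
  by rewrite divr_gt0 // lt_min !subr_gt0 us.
set m := Num.min _ _.
have m1 : m <= s - u by rewrite /m ge_min lexx.
have m2 : m <= v - s by rewrite /m ge_min lexx orbT.
have m0 : 0 < m by rewrite /m lt_min !subr_gt0 us.
lra.
Qed.

(** The conclusion is the hypothesis [int_h] with [h] replaced by [h * phi], so it can be iterated
    to insert any power of [phi]. *)
Lemma exponential_family_integrable s : u < s -> s < v ->
  mu.-integrable B (EFin \o (fun y => h y * phi y * expR (s * phi y))).
Proof.
move=> us sv; have [e e0 [ue ev]] := exponential_family_margin us sv.
apply: (le_integrable _ _ _ (@int_dominating (s - 2 * e) (s + 2 * e) e _ _ _ _)) => //; try lra.
  apply/measurable_EFinP; rewrite (_ : (fun y => _) = (fun y => h y * expR (s * phi y)) \* phi).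
    apply: measurable_funM => //.
    by have /integrableP[/measurable_EFinP] := int_h us sv.
  by apply/funext => y /=; ring.
move=> y By; rewrite /= lee_fin (le_trans _ (ler_norm _)) // dominated //; lra.
Qed.

(** Used with [phi = ln] for the Gamma integral and with [phi = lnratio] for the moments of the
    weight. The dominating function is built from the two fixed parameters [s - 2 e] and
    [s + 2 e]. *)
Lemma exponential_family_is_derive s : u < s -> s < v ->
  is_derive s 1 (fun x => \int[mu]_(y in B) (h y * expR (x * phi y)))
    (\int[mu]_(y in B) (h y * phi y * expR (s * phi y))).
Proof.
move=> us sv; have [e e0 [ue ev]] := exponential_family_margin us sv.
pose f x y := h y * expR (x * phi y).
have Is : `]s - e, s + e[%classic s by rewrite /= in_itv /=; apply/andP; split; lra.
have intf (x : R) : `]s - e, s + e[%classic x -> mu.-integrable B (EFin \o f x).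
  by rewrite /= in_itv /= => /andP[? ?]; apply: int_h; lra.
have df (x : R) y : is_derive x 1 (f ^~ y) (h y * phi y * expR (x * phi y)).
  exact: is_derive_expR_scaled.
have intG := @int_dominating (s - 2 * e) (s + 2 * e) e ltac:(lra) ltac:(lra) ltac:(lra) ltac:(lra).
have G0 y : 0 <= dominating (s - 2 * e) (s + 2 * e) e y.
  by rewrite mulr_ge0 ?invr_ge0 ?addr_ge0 // ltW.
have Gub (x : R) y : `]s - e, s + e[%classic x -> B y ->
    `|partial1of2 f x y| <= dominating (s - 2 * e) (s + 2 * e) e y.
  rewrite /= in_itv /= => /andP[? ?] _.
  by rewrite partial1of2E derive_val dominated //; lra.
have derf (x : R) y : `]s - e, s + e[%classic x -> B y -> derivable (f ^~ y) x 1.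
  by move=> _ _; exact: ex_derive.
split.
  exact: (derivable_under_integral mB Is intf derf G0 intG Gub).
rewrite -derive1E (differentiation_under_integral mB Is intf derf G0 intG Gub).
by apply: eq_Rintegral => y _; rewrite partial1of2E derive_val.
Qed.

End ExponentialFamily.

(** * Integrals over sets exhausted by compact segments *)

Section Exhaustion.
Variable R : realType.
Notation mu := (@lebesgue_measure R).
Implicit Types (U V : set R) (f F G phi : R -> R).

Definition segment_exhaustion U (c d : nat -> R) :=
  [/\ nonincreasing_seq c, nondecreasing_seq d, forall n, c n < d n &
      \bigcup_n `[c n, d n]%classic = U].

Variables (U : set R) (c d : nat -> R).
Hypothesis Ucd : segment_exhaustion U c d.

Let cd n : c n < d n. Proof. by case: Ucd. Qed.

Lemma exhaustion_segment n x : c n <= x -> x <= d n -> U x.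
Proof.
by move=> cx xd; case: Ucd => _ _ _ <-; exists n => //=; rewrite in_itv /= cx.
Qed.


Lemma exhaustion_mem x : U x -> exists n, c n <= x /\ x <= d n.
Proof.
case: Ucd => _ _ _ <- [n _] /=; rewrite in_itv /= => /andP[cx xd].
by exists n.
Qed.

Let nd_segments : nondecreasing_seq (fun n => `[c n, d n]%classic).
Proof.
move=> m n mn; rewrite subsetEset => x /=; rewrite !in_itv /= => /andP[cx xd].
case: Ucd => nc nd _ _.
by rewrite (le_trans (nc _ _ mn)) // (le_trans xd) // nd.
Qed.

Lemma exhaustion_within_segment f n : (forall x, U x -> {for x, continuous f}) ->
  {within `[c n, d n], continuous f}.
Proof.
move=> cf; apply: continuous_in_subspaceT => x.
by rewrite inE /= in_itv /= => /andP[cx xd]; exact: cf (exhaustion_segment cx xd).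
Qed.

Lemma exhaustion_measurable : measurable U.
Proof.
case: Ucd => _ _ _ <-; apply: bigcupT_measurable => n; exact: measurable_itv.
Qed.

Let measurable_segment f n : (forall x, U x -> {for x, continuous f}) ->
  measurable_fun `[c n, d n] f.
Proof.
by move=> cf; apply: subspace_continuous_measurable_fun => //; exact: exhaustion_within_segment.
Qed.

Lemma exhaustion_measurable_fun f : (forall x, U x -> {for x, continuous f}) ->
  measurable_fun U f.
Proof.
move=> cf; case: (Ucd) => _ _ _ <-; apply/measurable_fun_bigcup => // n.
exact: measurable_segment.
Qed.

Lemma ge0_exhaustion_cvg f : (forall x, U x -> {for x, continuous f}) ->
  (forall x, U x -> 0 <= f x) ->
  (\int[mu]_(x in `[c n, d n]) (f x)%:E)%E @[n --> \oo] -->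
  (\int[mu]_(x in U) (f x)%:E)%E.
Proof.
move=> cf f0; case: (Ucd) => _ _ _ <-.
apply: ge0_nondecreasing_set_cvg_integral => //.
  by move=> n; apply/measurable_EFinP; exact: measurable_segment.
move=> n x /=; rewrite in_itv /= lee_fin => /andP[cx xd]; exact: f0 (exhaustion_segment cx xd).
Qed.

Lemma exhaustion_derivable_segment F F' n : (forall x, U x -> is_derive x 1 F (F' x)) ->
  derivable_oo_LRcontinuous F (c n) (d n).
Proof.
move=> dF.
have cF x : U x -> {for x, continuous F}.
  move=> Ux; have := dF _ Ux => dFx.
  by apply: differentiable_continuous; apply/derivable1_diffP; exact: ex_derive.
split.
- move=> x; rewrite in_itv /= => /andP[/ltW cx /ltW xd].
  by have := dF _ (exhaustion_segment cx xd) => dFx; exact: ex_derive.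
- by apply: cvg_at_right_filter; apply: cF; apply: exhaustion_segment (lexx _) (ltW (cd n)).
- by apply: cvg_at_left_filter; apply: cF; apply: exhaustion_segment (ltW (cd n)) (lexx _).
Qed.

Lemma exhaustion_derive1_segment F F' n : (forall x, U x -> is_derive x 1 F (F' x)) ->
  {in `]c n, d n[, (F^`())%classic =1 F'}.
Proof.
move=> dF x; rewrite in_itv /= => /andP[/ltW cx /ltW xd].
by have := dF _ (exhaustion_segment cx xd) => dFx; rewrite derive1E derive_val.
Qed.

Lemma segment_FTC F f n : (forall x, U x -> {for x, continuous f}) ->
  (forall x, U x -> is_derive x 1 F (f x)) ->
  (\int[mu]_(x in `[c n, d n]) (f x)%:E = (F (d n) - F (c n))%:E)%E.
Proof.
move=> cf dF; rewrite (@continuous_FTC2 _ f F) ?EFinB //.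
- exact: exhaustion_within_segment.
- exact: exhaustion_derivable_segment dF.
- exact: exhaustion_derive1_segment.
Qed.

(** The integral over each segment is at most [F (d n) - F (c n)], hence at most [2 K] for every
    [n]: convergence follows from a bounded primitive of a majorant. *)
Lemma dominated_by_derivative_integrable f F F' (K : R) :
  (forall x, U x -> {for x, continuous f}) -> (forall x, U x -> 0 <= f x) ->
  (forall x, U x -> {for x, continuous F'}) ->
  (forall x, U x -> is_derive x 1 F (F' x)) ->
  (forall x, U x -> f x <= F' x) -> (forall x, U x -> `|F x| <= K) ->
  mu.-integrable U (EFin \o f).
Proof.
move=> cf f0 cF' dF fF' FK; apply/integrableP; split.
  by apply/measurable_EFinP; exact: exhaustion_measurable_fun.
rewrite (_ : \int[mu]_(x in U) _ = \int[mu]_(x in U) (f x)%:E)%E; last first.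
  by apply: eq_integral => x; rewrite inE => Ux; rewrite gee0_abs // lee_fin f0.
apply: (@le_lt_trans _ _ (2 * K)%:E); last exact: ltry.
apply: (@cvge_le _ _ _ _ _ _ _ _ (ge0_exhaustion_cvg cf f0)).
apply: nearW => n.
have seg x : (`[c n, d n]%classic x -> U x).
  by rewrite /= in_itv /= => /andP[cx xd]; exact: exhaustion_segment cx xd.
apply: (@le_trans _ _ (\int[mu]_(x in `[c n, d n]) (F' x)%:E)%E).
  apply: ge0_le_integral => //.
  - by move=> x /seg Ux; rewrite lee_fin f0.
  - by apply/measurable_EFinP; exact: measurable_segment.
  - by apply/measurable_EFinP; exact: measurable_segment.
  - by move=> x /seg Ux; rewrite lee_fin fF'.
rewrite (segment_FTC n cF' dF) lee_fin.
have := FK _ (exhaustion_segment (lexx _) (ltW (cd n))); have := FK _ (exhaustion_segment (ltW (cd n)) (lexx _)).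
by rewrite !ler_norml => /andP[? ?] /andP[? ?]; lra.
Qed.

(** Since [f] may change sign, the limit is taken by dominated convergence, with [|f|] dominating
    its restrictions to the segments. *)
Lemma exhaustion_FTC F f (A B : R) : (forall x, U x -> {for x, continuous f}) ->
  (forall x, U x -> is_derive x 1 F (f x)) ->
  mu.-integrable U (EFin \o f) ->
  F (c n) @[n --> \oo] --> A -> F (d n) @[n --> \oo] --> B ->
  \int[mu]_(x in U) f x = B - A.
Proof.
move=> cf dF intf FA FB.
pose S n := `[c n, d n]%classic.
have SU n : S n `<=` U.
  by move=> x; rewrite /S /= in_itv /= => /andP[cx xd]; exact: exhaustion_segment cx xd.
have mU := exhaustion_measurable.
have mS n : measurable (S n) by exact: measurable_itv.
have [|||||_ _ H] := @dominated_convergence _ _ R mu U mU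
    (fun n => (EFin \o f) \_ (S n)) (EFin \o f) (abse \o (EFin \o f)).
- move=> n; apply/(measurable_restrict _ (mS n) mU); rewrite setIidr //.
  by apply/measurable_EFinP; exact: measurable_segment.
- by apply/measurable_EFinP; exact: exhaustion_measurable_fun.
- apply/aeW => x Ux; apply: cvg_near_cst.
  have [n [cx xd]] := exhaustion_mem Ux; near=> m.
  have nm : (n <= m)%N by near: m; exact: nbhs_infty_ge.
  have := nd_segments nm; rewrite subsetEset => /(_ x).
  by rewrite patchE /= in_itv /= cx xd => /(_ isT) ?; rewrite mem_set.
- exact: integrable_abse.
- apply/aeW => x n Ux; rewrite /= patchE; case: ifPn => // _.
  by rewrite abse0.
have E n : (\int[mu]_(x in U) ((EFin \o f) \_ (S n)) x = (F (d n) - F (c n))%:E)%E.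
  by rewrite -(segment_FTC n cf dF) -integral_mkcondr setIidr.
have {H}H : (F (d n) - F (c n))%:E @[n --> \oo] --> (\int[mu]_(x in U) (f x)%:E)%E.
  by move: H; under eq_fun do rewrite /= E.
have H2 : (F (d n) - F (c n))%:E @[n --> \oo] --> (B - A)%:E.
  by apply: cvg_EFin; [exact: nearW|exact: cvgB].
rewrite /Rintegral (cvg_unique _ H H2) //.
Unshelve. all: by end_near. Qed.


Lemma exhaustion_image (V : set R) (phi psi : R -> R) : is_interval V ->
  (forall x, U x -> V (phi x)) -> (forall y, V y -> U (psi y) /\ phi (psi y) = y) ->
  {in U &, {homo phi : x y / x < y}} ->
  segment_exhaustion V (phi \o c) (phi \o d).
Proof.
move=> iV UV VU incr; case: (Ucd) => nc nd _ _.
have Uc n : U (c n) by apply: exhaustion_segment (lexx _) (ltW (cd n)).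
have Ud n : U (d n) by apply: exhaustion_segment (ltW (cd n)) (lexx _).
have le x y : U x -> U y -> x <= y -> phi x <= phi y.
  move=> Ux Uy; rewrite le_eqVlt => /predU1P[->//|xy].
  by apply/ltW/incr; rewrite ?inE.
split.
- by move=> m n mn /=; apply: le => //; exact: nc.
- by move=> m n mn /=; apply: le => //; exact: nd.
- by move=> n /=; apply: incr; rewrite ?inE.
- apply/seteqP; split => [y [n _] /=|y Vy].
    rewrite in_itv /= => /andP[cy yd].
    by apply: (iV (phi (c n)) (phi (d n))); rewrite ?cy ?yd //; exact: UV.
  have [Up <-] := VU _ Vy; have [n [cp pd]] := exhaustion_mem Up.
  by exists n => //=; rewrite in_itv /=; apply/andP; split; exact: le.
Qed.

End Exhaustion.

Section Substitution.
Variables (R : realType) (U : set R) (c d : nat -> R).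
Hypothesis Ucd : segment_exhaustion U c d.
Notation mu := (@lebesgue_measure R).

Let cd n : c n < d n. Proof. by case: Ucd. Qed.

(** Substitution holds on every segment, and nonnegativity lets both sides converge monotonically.
    The equality is between extended reals, so it applies before finiteness is known. The map [psi]
    witnesses surjectivity. *)
Lemma ge0_exhaustion_substitution (V : set R) (phi phi' psi G : R -> R) :
  is_interval V ->
  (forall x, U x -> V (phi x)) -> (forall y, V y -> U (psi y) /\ phi (psi y) = y) ->
  {in U &, {homo phi : x y / x < y}} ->
  (forall x, U x -> is_derive x 1 phi (phi' x)) ->
  (forall x, U x -> {for x, continuous phi'}) ->
  (forall x, U x -> 0 <= phi' x) ->
  (forall y, V y -> {for y, continuous G}) ->
  (forall y, V y -> 0 <= G y) ->
  (\int[mu]_(y in V) (G y)%:E = \int[mu]_(x in U) (G (phi x) * phi' x)%:E)%E.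
Proof.
move=> iV UV VU incr dphi cphi' phi'0 cG G0.
have EV := exhaustion_image Ucd iV UV VU incr.
have H1 := ge0_exhaustion_cvg EV cG G0.
have cphi x : U x -> {for x, continuous phi}.
  move=> Ux; have := dphi _ Ux => dphix.
  by apply: differentiable_continuous; apply/derivable1_diffP; exact: ex_derive.
have cGphi x : U x -> {for x, continuous (fun x => G (phi x) * phi' x)}.
  move=> Ux; apply: cvgM; last exact: cphi'.
  by apply: (@continuous_comp _ _ _ phi G); [exact: cphi | exact/cG/UV].
have H2 := ge0_exhaustion_cvg Ucd cGphi (fun x Ux => mulr_ge0 (G0 _ (UV _ Ux)) (phi'0 _ Ux)).
have E n : (\int[mu]_(y in `[phi (c n), phi (d n)]) (G y)%:E =
    \int[mu]_(x in `[c n, d n]) (G (phi x) * phi' x)%:E)%E.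
  have Uc : U (c n) by exact: (exhaustion_segment Ucd (lexx _) (ltW (cd n))).
  have Ud : U (d n) by exact: (exhaustion_segment Ucd (ltW (cd n)) (lexx _)).
  have seg x : x \in `[c n, d n] -> U x.
    by rewrite in_itv /= => /andP[cx xd]; exact: (exhaustion_segment Ucd cx xd).
  have Ephi x : x \in `]c n, d n[ -> (phi^`())%classic x = phi' x.
    exact: (exhaustion_derive1_segment Ucd dphi).
  rewrite integration_by_substitution_increasing.
  (* [Ephi] identifies the derivative of [phi] at interior points, so both integrals are moved to
     the open segment. *)
  - have mo : measurable_fun `]c n, d n[ (fun x => G (phi x) * phi' x).
      apply: (measurable_funS (measurable_itv `[c n, d n]) (@subset_itv_oo_cc _ _ _ _)).
      by apply: subspace_continuous_measurable_fun => //; exact: (exhaustion_within_segment Ucd).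
    rewrite integral_itv_bndoo; last first.
      apply/measurable_EFinP; apply: eq_measurable_fun mo => x.
      by rewrite inE /= => xcd; rewrite fctE /= Ephi.
    rewrite [RHS]integral_itv_bndoo; last exact/measurable_EFinP.
    by apply: eq_integral => x; rewrite inE /= => xcd; rewrite fctE /= Ephi.
  - exact: ltW.
  - by move=> x y /seg Ux /seg Uy xy; apply: incr => //; rewrite inE.
  - move=> x xcd; rewrite /continuous_at Ephi //.
    apply: cvg_trans (cphi' _ (seg _ (subset_itv_oo_cc xcd))).
    apply: near_eq_cvg; near=> z; rewrite Ephi //; near: z; exact: (near_in_itvoo xcd).
  - apply/cvg_ex; exists (phi' (c n)).
    apply: cvg_trans (cvg_at_right_filter (cphi' _ Uc)).
    apply: near_eq_cvg; near=> z.
    have cz : c n < z by near: z; exact: nbhs_right_gt.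
    have zd : z < d n by near: z; exact: nbhs_right_lt.
    by rewrite Ephi // in_itv /= cz.
  - apply/cvg_ex; exists (phi' (d n)).
    apply: cvg_trans (cvg_at_left_filter (cphi' _ Ud)).
    apply: near_eq_cvg; near=> z.
    have cz : c n < z by near: z; exact: nbhs_left_gt.
    have zd : z < d n by near: z; exact: nbhs_left_lt.
    by rewrite Ephi // in_itv /= cz.
  - exact: (exhaustion_derivable_segment Ucd _ dphi).
  - exact: (exhaustion_within_segment EV).
by move: H1; rewrite /= (funext E) => H1; exact: cvg_unique H1 H2.
Unshelve. all: by end_near. Qed.

End Substitution.

Section Elementary.
Variable R : realType.
Implicit Types (x s k : R) (f : R -> R).

Lemma is_derive_continuous f x df : is_derive x 1 f df -> {for x, continuous f}.
Proof.
by move=> dfx; apply: differentiable_continuous; apply/derivable1_diffP; exact: ex_derive.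
Qed.

(** The real power [(1 + c x)^k] in exponential form; [c = -1] and [c = 1] give the two factors of
    the weight. *)
Lemma is_derive_expR_ln_affine k c x : 0 < 1 + c * x ->
  is_derive x 1 (fun y => expR (k * ln (1 + c * y)))
    (k * c / (1 + c * x) * expR (k * ln (1 + c * x))).
Proof.
move=> x0.
have D1 : is_derive x 1 (fun y : R => 1 + c * y) c.
  by apply: is_derive_eq; rewrite add0r mul1r /GRing.scale /= mulr1.
have D2 := @is_derive1_comp _ (@ln R) (fun y => 1 + c * y) x _ _ (is_derive1_ln x0) D1.
have D3 : is_derive x 1 (fun y => k * ln (1 + c * y)) (k * (c / (1 + c * x))).
  apply: (@is_derive_eq _ _ _ (k \*: (@ln R \o (fun y => 1 + c * y))) _ _ _ _ _).
  by rewrite /GRing.scale /= [c / _]mulrC.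
have D4 := @is_derive1_comp _ expR (fun y => k * ln (1 + c * y)) x _ _ (is_derive_expR _) D3.
by apply: is_derive_eq; rewrite mulrC !mulrA.
Qed.

Lemma ln_lt1 x : 0 < x -> x <= 2 -> ln x <= 1.
Proof.
move=> x0 x2; have H : -1 < x - 1 by lra.
by have := le_ln1Dx H; rewrite subrKC; lra.
Qed.

(** The shift to [n + 2] makes the segment nondegenerate already at [n = 0]. *)
Lemma segment_exhaustion_oo :
  segment_exhaustion `]-1, 1[%classic (fun n => -1 + n.+2%:R^-1 : R) (fun n => 1 - n.+2%:R^-1).
Proof.
have inv_le m n : (m <= n)%N -> (n.+2%:R^-1 : R) <= m.+2%:R^-1.
  by move=> mn; rewrite lef_pV2 ?posrE ?ltr0n // ler_nat !ltnS.
have i0 n : 0 < (n.+2%:R^-1 : R) by rewrite invr_gt0 ltr0n.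
have i1 n : (n.+2%:R^-1 : R) < 1 by rewrite invf_lt1 ?ltr0n // ltr1n.
have sep (i : R) : i < 1 -> -1 + i < 1 - i by lra.
have inside (i x : R) : 0 < i -> -1 + i <= x -> x <= 1 - i -> -1 < x < 1.
  by move=> ? ? ?; apply/andP; split; lra.
have inside2 (i x : R) : i <= 1 + x -> i <= 1 - x -> -1 + i <= x <= 1 - i.
  by move=> ? ?; apply/andP; split; lra.
split.
- by move=> m n /inv_le; rewrite lerD2l.
- by move=> m n /inv_le; rewrite lerD2l lerN2.
- by move=> n; apply: sep (i1 n).
- apply/seteqP; split => x.
    by move=> [n _] /=; rewrite !in_itv /= => /andP[? ?]; apply: (inside _ _ (i0 n)).
  rewrite /= in_itv /= => /andP[x1 x2].
  have [n [n1 n2]] : exists n, (n.+2%:R^-1 : R) <= 1 + x /\ n.+2%:R^-1 <= 1 - x.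
    have [m [m0 mx]] : exists m : R, 0 < m /\ (m <= 1 + x /\ m <= 1 - x).
      exists (Num.min (1 + x) (1 - x)); rewrite lt_min !ge_min !lexx orbT.
      by split => //; apply/andP; split; lra.
    exists (Num.trunc m^-1); suff H : ((Num.trunc m^-1).+2%:R^-1 : R) <= m.
      by case: mx => ? ?; split; exact: le_trans H _.
    rewrite -[leRHS]invrK lef_pV2 ?posrE ?ltr0n ?invr_gt0 //.
    by rewrite ltW // (lt_le_trans (truncnS_gt _)) // ler_nat.
  by exists n => //=; rewrite in_itv /=; exact: inside2.
Qed.

Lemma segment_exhaustion_0y :
  segment_exhaustion `]0, +oo[%classic (fun n => n.+2%:R^-1 : R) (fun n => n.+2%:R).
Proof.
split.
- by move=> m n mn; rewrite lef_pV2 ?posrE ?ltr0n // ler_nat !ltnS.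
- by move=> m n mn; rewrite ler_nat !ltnS.
- by move=> n; rewrite (@lt_trans _ _ 1) ?invf_lt1 ?ltr0n ?ltr1n.
- apply/seteqP; split => x.
    move=> [n _] /=; rewrite !in_itv /= andbT => /andP[? _].
    by rewrite (@lt_le_trans _ _ n.+2%:R^-1) ?invr_gt0 ?ltr0n.
  rewrite /= in_itv /= andbT => x0.
  pose m := maxn (Num.trunc x^-1) (Num.trunc x).
  exists m => //=; rewrite in_itv /= -[X in _ <= X <= _]invrK; apply/andP; split.
    rewrite lef_pV2 ?posrE ?ltr0n ?invr_gt0 // ltW // (lt_le_trans (truncnS_gt _)) //.
    by rewrite ler_nat ltnS leqW // leq_maxl.
  rewrite invrK ltW // (lt_le_trans (truncnS_gt _)) //.
  by rewrite ler_nat ltnS leqW // leq_maxr.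
Qed.

(** The positive minimum of [f] on the first segment, times the length of that segment, bounds the
    integral from below. *)
Lemma exhaustion_integral_gt0 U (c d : nat -> R) f : segment_exhaustion U c d ->
  (forall x, U x -> {for x, continuous f}) -> (forall x, U x -> 0 < f x) ->
  (0 < \int[@lebesgue_measure R]_(x in U) (f x)%:E)%E.
Proof.
move=> EU cf f0.
have cd0 : c 0%N < d 0%N by case: EU.
have [z zI zmin] := EVT_min (ltW cd0) (exhaustion_within_segment EU (n := 0%N) cf).
have seg x : x \in `[c 0%N, d 0%N] -> U x.
  by rewrite in_itv /= => /andP[cx xd]; exact: (exhaustion_segment EU cx xd).
have fz : 0 < f z by apply/f0/seg.
apply: (@lt_le_trans _ _ (\int[@lebesgue_measure R]_(x in `[c 0%N, d 0%N]) (cst (f z)%:E) x)%E).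
  have /= -> := @integral_cst _ _ R (@lebesgue_measure R) `[c 0%N, d 0%N]%classic (measurable_itv _) (f z)%:E.
  rewrite lebesgue_measure_itv /= lte_fin cd0 -EFinD -EFinM lte_fin.
  by rewrite mulr_gt0 // subr_gt0.
have mf : measurable_fun U f := exhaustion_measurable_fun EU cf.
apply: (@le_trans _ _ (\int[@lebesgue_measure R]_(x in `[c 0%N, d 0%N]) (f x)%:E)%E).
  apply: ge0_le_integral => //.
  - by move=> x _; rewrite lee_fin ltW.
  - apply/measurable_EFinP; apply: (measurable_funS (exhaustion_measurable EU) _ mf).
    by move=> x; exact: seg.
apply: ge0_subset_integral => //.
- exact: exhaustion_measurable EU.
- exact/measurable_EFinP.
- by move=> x Ux; rewrite lee_fin ltW // f0.
Qed.

End Elementary.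

(** * Weight and Beta integral *)

Section Weight.
Variable R : realType.
Notation mu := (@lebesgue_measure R).
Implicit Types (x s : R) (p : {poly R}) (n : nat).

Definition lnratio x : R := ln ((1 - x) / (1 + x)).

Definition expweight s x : R := (1 + x) * expR (s * lnratio x).

Local Notation I := (`]-1, 1[%classic : set R).

Let mI x : I x -> 0 < 1 + -1 * x /\ 0 < 1 + 1 * x.
Proof. by rewrite /= in_itv /= => /andP[? ?]; split; lra. Qed.

Lemma lnratioE x : I x -> lnratio x = ln (1 + -1 * x) - ln (1 + 1 * x).
Proof.
move=> /mI[x1 x2]; rewrite mulN1r mul1r in x1 x2 *.
by rewrite /lnratio ln_div ?posrE.
Qed.

Lemma grosjean2_weightE s x : I x -> grosjean2_weight s x = expweight s x.
Proof.
move=> /mI[x1 x2]; rewrite mulN1r mul1r in x1 x2 *.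
by rewrite /grosjean2_weight /expweight mulrC /powR gt_eqF // divr_gt0.
Qed.

Lemma expweight_expR s x : I x ->
  expweight s x = expR (s * ln (1 + -1 * x)) * expR ((1 - s) * ln (1 + 1 * x)).
Proof.
move=> Ix; have [x1 x2] := mI Ix; rewrite /expweight lnratioE // -expRD.
have {1}-> : 1 + x = expR (ln (1 + 1 * x)) by rewrite lnK ?posrE // mul1r.
by rewrite -expRD; congr expR; ring.
Qed.

Lemma expweight_gt0 s x : I x -> 0 < expweight s x.
Proof. by move=> Ix; rewrite expweight_expR // mulr_gt0 ?expR_gt0. Qed.

Let continuous_expR_ln k (c x : R) : 0 < 1 + c * x ->
  {for x, continuous (fun y => expR (k * ln (1 + c * y)))}.
Proof. by move=> x0; apply: is_derive_continuous; exact: is_derive_expR_ln_affine. Qed.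

Let I_near x : I x -> \forall y \near x, I y.
Proof. by move=> Ix; apply: near_in_itvoo. Qed.

Lemma continuous_expweight s x : I x -> {for x, continuous (expweight s)}.
Proof.
move=> Ix; have [x1 x2] := mI Ix.
rewrite /prop_for /continuous_at expweight_expR //.
have H : expR (s * ln (1 + -1 * y)) * expR ((1 - s) * ln (1 + 1 * y)) @[y --> x] -->
    expR (s * ln (1 + -1 * x)) * expR ((1 - s) * ln (1 + 1 * x)).
  by apply: cvgM; exact: continuous_expR_ln.
apply: cvg_trans H.
apply: near_eq_cvg; near=> y; rewrite expweight_expR //.
by near: y; exact: I_near.
Unshelve. all: by end_near. Qed.

(** On each half of the interval one factor of the weight has base in [[1, 2]] and exponent at most
    [2], hence is at most [4]. The majorant [4 ((1 - x)^s + (1 + x)^(1-s))] has a bounded primitive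
    because [s + 1] and [2 - s] are positive. *)
Lemma integrable_expweight s : -1 < s -> s < 2 -> mu.-integrable I (EFin \o expweight s).
Proof.
move=> s1 s2.
pose a0 k (c x : R) := expR (k * ln (1 + c * x)).
pose F := 4 \*: ((- (s + 1)^-1) \*: a0 (s + 1) (-1) \+ (2 - s)^-1 \*: a0 (2 - s) 1).
pose F' x := 4 * (a0 s (-1) x + a0 (1 - s) 1 x).
have e1 : s + 1 != 0 by rewrite gt_eqF //; lra.
have e2 : 2 - s != 0 by rewrite gt_eqF //; lra.
have a0E k c x : 0 < 1 + c * x -> a0 k c x / (1 + c * x) = a0 (k - 1) c x.
  move=> x0; rewrite /a0 mulrBl mul1r expRD expRN lnK //.
have a0_ge0 k c x : 0 <= a0 k c x by exact: expR_ge0.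
have a0_le k c x : 0 <= k -> 0 < 1 + c * x -> 1 + c * x <= 2 -> a0 k c x <= expR k.
  by move=> k0 x0 x2; rewrite /a0 ler_expR ler_piMr // ln_lt1.
pose K := 4 * (expR (s + 1) / (s + 1) + expR (2 - s) / (2 - s)).
apply: (@dominated_by_derivative_integrable _ _ _ _ (segment_exhaustion_oo R) _ F F' K).
- exact: continuous_expweight.
- by move=> x Ix; exact/ltW/expweight_gt0.
- move=> x /mI[x1 x2]; apply: cvgM; first exact: cvg_cst.
  by apply: cvgD; exact: continuous_expR_ln.
- move=> x /mI[x1 x2].
  have D1 := is_derive_expR_ln_affine (s + 1) x1.
  have D2 := is_derive_expR_ln_affine (2 - s) x2.
  apply: is_derive_eq; rewrite /F' /GRing.scale /=; congr (4 * (_ + _)).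
    rewrite -[s in RHS](addrK 1) -a0E // /a0; field.
    by rewrite e1 gt_eqF.
  have -> : 1 - s = 2 - s - 1 by ring.
  rewrite -a0E // /a0; field.
  by rewrite e2 mul1r in x2 *; rewrite gt_eqF.
- move=> x Ix; rewrite expweight_expR // /F' -/(a0 _ _ _) -/(a0 _ _ _).
  have le4 k c : k <= 2 -> 0 <= ln (1 + c * x) -> 1 + c * x <= 2 -> 0 < 1 + c * x -> a0 k c x <= 4.
    move=> k2 l0 x2 x0; rewrite (@le_trans _ _ ((1 + c * x) ^+ 2)) //; last by nra.
    by rewrite -[X in _ <= X ^+ 2]lnK // -expRM_natl /a0 ler_expR ler_wpM2r.
  have [x1 x2] := mI Ix.
  move: Ix; rewrite /= in_itv /= => /andP[xl xr].
  have [xneg|xpos] := leP x 0.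
    rewrite mulrDr (@le_trans _ _ (4 * a0 (1 - s) 1 x)) ?lerDr ?mulr_ge0 //.
    rewrite ler_wpM2r // le4 //; [lra| |lra].
    by apply: ln_ge0; lra.
  rewrite mulrDr (@le_trans _ _ (4 * a0 s (-1) x)) ?lerDl ?mulr_ge0 //.
  rewrite mulrC ler_wpM2r // le4 //; [lra| |lra].
  by apply: ln_ge0; lra.
- move=> x /[dup] /mI[x1 x2]; rewrite /= in_itv /= => /andP[xl xr].
  rewrite /F /K /= /GRing.scale /= normrM ger0_norm // ler_wpM2l //.
  have i1 : 0 <= (s + 1)^-1 by rewrite invr_ge0; lra.
  have i2 : 0 <= (2 - s)^-1 by rewrite invr_ge0; lra.
  rewrite (le_trans (ler_normD _ _)) // !normrM normrN !(ger0_norm i1) !(ger0_norm i2).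
  rewrite !(ger0_norm (a0_ge0 _ _ _)) lerD //.
    by rewrite mulrC ler_wpM2r // a0_le //; lra.
  by rewrite mulrC ler_wpM2r // a0_le //; lra.
Qed.

Lemma normr_horner_le_sum p x : `|x| <= 1 -> `|p.[x]| <= \sum_(i < size p) `|p`_i|.
Proof.
move=> x1; rewrite horner_coef (le_trans (ler_norm_sum _ _ _)) //.
by apply: ler_sum => i _; rewrite normrM normrX ler_piMr // exprn_ile1.
Qed.

Lemma integrable_horner_expweight p s : -1 < s -> s < 2 ->
  mu.-integrable I (EFin \o (fun x => p.[x] * (1 + x) * expR (s * lnratio x))).
Proof.
move=> s1 s2; pose C := \sum_(i < size p) `|p`_i|.
have cp x : I x -> {for x, continuous (horner p \* expweight s)}.
  by move=> Ix; apply: cvgM; [exact: continuous_horner|exact: continuous_expweight].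
have iC : mu.-integrable I (fun x => C%:E * (EFin \o expweight s) x)%E.
  by apply: integrableZl => //; exact: integrable_expweight.
rewrite (_ : EFin \o _ = EFin \o (horner p \* expweight s)); last first.
  by apply/funext => x /=; rewrite /expweight mulrA.
apply: le_integrable iC => //.
  by apply/measurable_EFinP; exact: exhaustion_measurable_fun (segment_exhaustion_oo R) _ cp.
move=> x Ix; rewrite lee_fin /= !normrM ler_wpM2r // [leRHS]ger0_norm ?sumr_ge0 //.
apply: normr_horner_le_sum; move: Ix; rewrite /= in_itv /= => /andP[? ?].
by rewrite ler_norml; apply/andP; split; lra.
Qed.

Lemma measurable_lnratio : measurable_fun I lnratio.
Proof.
apply: (exhaustion_measurable_fun (segment_exhaustion_oo R)) => x Ix.
have [x1 x2] := mI Ix.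
rewrite /prop_for /continuous_at lnratioE //.
have cl c : 0 < 1 + c * x -> ln (1 + c * y) @[y --> x] --> ln (1 + c * x).
  move=> x0; apply: continuous_cvg; first exact: continuous_ln.
  by apply: cvgD; [exact: cvg_cst|apply: cvgM; [exact: cvg_cst|exact: cvg_id]].
apply: cvg_trans (cvgB (cl _ x1) (cl _ x2)).
apply: near_eq_cvg; near=> y; rewrite lnratioE //.
by near: y; exact: I_near.
Unshelve. all: by end_near. Qed.

End Weight.

(** * Euler's Beta integral in extended reals *)

Section GammaBeta.
Variable R : realType.
Notation mu := (@lebesgue_measure R).
Implicit Types (x u t s : R) (n : nat).

Local Notation I := (`]-1, 1[%classic : set R).
Local Notation E := (`]0, +oo[%classic : set R).

(** Euler's integrand arranged as an exponential family in [t], with [h u = expR (- u) / u] and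
    [phi = ln]. *)
Definition gamma_kernel t u : R := expR (- u) / u * expR (t * ln u).

(** Extended-valued, so that the Beta identity can be proved first and convergence deduced from
    it. *)
Definition egamma t : \bar R := (\int[mu]_(u in E) (gamma_kernel t u)%:E)%E.

Let E_gt0 u : E u -> 0 < u. Proof. by rewrite /= in_itv /= andbT. Qed.
Let gt0_E u : 0 < u -> E u. Proof. by rewrite /= in_itv /= andbT. Qed.
Let mI x : I x -> 0 < 1 - x /\ 0 < 1 + x.
Proof. by rewrite /= in_itv /= => /andP[? ?]; split; lra. Qed.
Let I_m x : 0 < 1 - x -> 0 < 1 + x -> I x.
Proof. by move=> ? ?; rewrite /= in_itv /=; apply/andP; split; lra. Qed.

Lemma gamma_kernelE t u : 0 < u -> u `^ (t - 1) * expR (- u) = gamma_kernel t u.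
Proof.
move=> u0; rewrite /powR gt_eqF // mulrBl mul1r expRD (expRN (ln u)) lnK ?posrE //.
by rewrite /gamma_kernel; ring.
Qed.

Lemma gamma_kernel_gt0 t u : 0 < u -> 0 < gamma_kernel t u.
Proof. by move=> u0; rewrite /gamma_kernel !mulr_gt0 ?invr_gt0 ?expR_gt0. Qed.

Lemma gamma_kernel_nat n u : 0 < u -> gamma_kernel n.+1%:R u = u ^+ n * expR (- u).
Proof.
move=> u0; rewrite -gamma_kernelE // -natr1 addrK powR_mulrn ?ltW //.
Qed.

Lemma continuous_gamma_kernel t u : 0 < u -> {for u, continuous (gamma_kernel t)}.
Proof.
move=> u0; apply: cvgM; last first.
  have := is_derive_expR_ln_affine t (c := 1) (x := u - 1).
  rewrite mul1r subrKC => /(_ u0) /is_derive_continuous.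
  rewrite /prop_for /continuous_at mul1r subrKC => H.
  have H2 : (u' - 1) @[u' --> u] --> u - 1 by apply: cvgB; [exact: cvg_id|exact: cvg_cst].
  have := cvg_comp _ _ H2 H; apply: cvg_trans; apply: near_eq_cvg.
  by apply: nearW => z /=; rewrite mul1r subrKC.
apply: cvgM; first by apply: continuous_comp; [exact: opp_continuous|exact: continuous_expR].
by apply: cvgV; [rewrite gt_eqF|exact: cvg_id].
Qed.

Lemma egamma_gt0 t : (0 < egamma t)%E.
Proof.
apply: (exhaustion_integral_gt0 (segment_exhaustion_0y R)) => u /E_gt0 u0.
  exact: continuous_gamma_kernel.
exact: gamma_kernel_gt0.
Qed.

Let measurable_gamma_kernel t : measurable_fun E (gamma_kernel t).
Proof.
apply: (exhaustion_measurable_fun (segment_exhaustion_0y R)) => u /E_gt0 u0.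
exact: continuous_gamma_kernel.
Qed.

Lemma egamma_scale n u : 0 < u ->
  (\int[mu]_(v in E) (v ^+ n * expR (- (v * u)))%:E =
   (u ^- n.+1)%:E * egamma n.+1%:R)%E.
Proof.
move=> u0; have un0 : u ^+ n.+1 != 0 by rewrite expf_neq0 // gt_eqF.
have -> : egamma n.+1%:R = (\int[mu]_(v in E) (gamma_kernel n.+1%:R (u * v) * u)%:E)%E.
  apply: (@ge0_exhaustion_substitution _ _ _ _ (segment_exhaustion_0y R)
    E (fun v => u * v) (cst u) (fun v => u^-1 * v)).
  - exact: interval_is_interval.
  - by move=> v /E_gt0 v0; apply: gt0_E; rewrite mulr_gt0.
  - move=> v /E_gt0 v0; split; first by apply: gt0_E; rewrite mulr_gt0 ?invr_gt0.
    by rewrite mulVKf // gt_eqF.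
  - by move=> v w _ _ vw; rewrite ltr_pM2l.
  - move=> v _; apply: is_derive_eq; by rewrite /GRing.scale /= mulr1.
  - by move=> v _; exact: cvg_cst.
  - by move=> v _; rewrite /= ltW.
  - by move=> v /E_gt0 v0; exact: continuous_gamma_kernel.
  - by move=> v /E_gt0 v0; rewrite ltW // gamma_kernel_gt0.
rewrite -ge0_integralZl //=; first last.
+ by rewrite lee_fin invr_ge0 exprn_ge0 // ltW.
+ by move=> v /E_gt0 v0; rewrite lee_fin mulr_ge0 ?ltW // gamma_kernel_gt0 // mulr_gt0.
+ apply/measurable_EFinP; apply: (exhaustion_measurable_fun (segment_exhaustion_0y R)) => v /E_gt0 v0.
  apply: cvgM; last exact: cvg_cst.
  apply: (@continuous_comp _ _ _ (fun v => u * v) (gamma_kernel _)).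
    by apply: cvgM; [exact: cvg_cst|exact: cvg_id].
  by apply: continuous_gamma_kernel; rewrite mulr_gt0.
apply: eq_integral => v; rewrite inE => /E_gt0 v0; rewrite -EFinM; congr EFin.
rewrite gamma_kernel_nat ?mulr_gt0 // exprMn exprS [v * u]mulrC; field.
by rewrite expf_neq0 /= gt_eqF.
Qed.

(** For [v = u (1 + x) / (1 - x)] one has [u + v = u * lam x]. The product of the two Gamma
    integrands with the Jacobian is [K], and [q] is its part depending on [x] outside the
    exponential. *)
Let lam x : R := 2 / (1 - x).
Let q n s x : R := ((1 + x) / (1 - x)) ^+ n.+1 * expR (s * lnratio x) * (2 / (1 - x) ^+ 2).
Let K n s u x : R := u ^+ (2 * n).+2 * expR (- (u * lam x)) * q n s x.

Let continuous_1mV x : I x -> (1 - y)^-1 @[y --> x] --> (1 - x)^-1.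
Proof.
move=> /mI[x1 x2]; apply: cvgV; first by rewrite gt_eqF.
by apply: cvgB; [exact: cvg_cst|exact: cvg_id].
Qed.

Let continuous_1m_sq x : (1 - y) ^+ 2 @[y --> x] --> (1 - x) ^+ 2.
Proof.
have H : (1 - y) @[y --> x] --> 1 - x by apply: cvgB; [exact: cvg_cst|exact: cvg_id].
exact: (cvgM H H).
Qed.

Let continuous_lam x : I x -> {for x, continuous lam}.
Proof. by move=> Ix; apply: cvgM; [exact: cvg_cst|exact: continuous_1mV]. Qed.

Let measurable_q n s : measurable_fun I (q n s).
Proof.
have m1 : measurable_fun I (fun x : R => (1 + x) / (1 - x)).
  apply: (exhaustion_measurable_fun (segment_exhaustion_oo R)) => x Ix.
  by apply: cvgM; [apply: cvgD; [exact: cvg_cst|exact: cvg_id]|exact: continuous_1mV].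
apply: measurable_funM; first apply: measurable_funM.
- exact: measurable_funX.
- apply: measurableT_comp => //; apply: measurable_funM => //; exact: measurable_lnratio.
- apply: (exhaustion_measurable_fun (segment_exhaustion_oo R)) => x Ix; apply: cvgM; first exact: cvg_cst.
  have [x1 _] := mI Ix.
  apply: cvgV; first by rewrite expf_neq0 // gt_eqF.
  exact: continuous_1m_sq.
Qed.

Let q_ge0 n s x : I x -> 0 <= q n s x.
Proof.
move=> /mI[x1 x2]; rewrite mulr_ge0 //; last by rewrite divr_ge0 ?exprn_ge0 ?ltW.
by rewrite mulr_ge0 ?expR_ge0 // exprn_ge0 // divr_ge0 ?ltW.
Qed.

Let egamma_substitution t u : 0 < u -> egamma t =
  (\int[mu]_(x in I) (gamma_kernel t (u * ((1 + x) / (1 - x))) * (u * (2 / (1 - x) ^+ 2)))%:E)%E.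
Proof.
move=> u0.
apply: (@ge0_exhaustion_substitution _ _ _ _ (segment_exhaustion_oo R)
    E (fun x => u * ((1 + x) / (1 - x))) (fun x => u * (2 / (1 - x) ^+ 2))
    (fun v => (v - u) / (v + u))).
- exact: interval_is_interval.
- by move=> x /mI[x1 x2]; apply: gt0_E; rewrite mulr_gt0 // divr_gt0.
- move=> v /E_gt0 v0.
  have vu : 0 < v + u by rewrite addr_gt0.
  have e1 : 1 - (v - u) / (v + u) = 2 * u / (v + u) by field; rewrite gt_eqF.
  have e2 : 1 + (v - u) / (v + u) = 2 * v / (v + u) by field; rewrite gt_eqF.
  split; first by apply: I_m; rewrite ?e1 ?e2 divr_gt0 // mulr_gt0.
  rewrite e1 e2; field.
  by rewrite !gt_eqF.
- move=> x y; rewrite !inE => /mI[x1 x2] /mI[y1 y2] xy.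
  rewrite ltr_pM2l // ltr_pdivrMr // mulrAC ltr_pdivlMr //; nra.
- move=> x /mI[x1 x2].
  have D0 : is_derive x 1 (fun y : R => 1 - y) (-1).
    by apply: is_derive_eq; rewrite add0r mul1r.
  have D1 : is_derive x 1 (fun y : R => (1 - y)^-1) ((1 - x) ^- 2).
    have x1n : 1 - x != 0 by rewrite gt_eqF.
    have D := @is_deriveV _ (fun y : R => 1 - y) _ _ _ x1n D0.
    by apply: is_derive_eq; rewrite /GRing.scale /= mulrN1 opprK.
  have D2 : is_derive x 1 (fun y : R => 1 + y) 1.
    by apply: is_derive_eq; rewrite add0r ?mulr1.
  apply: is_derive_eq; rewrite /GRing.scale /=; field.
  by rewrite gt_eqF.
- move=> x Ix; have [x1 _] := mI Ix.
  apply: cvgM; first exact: cvg_cst; apply: cvgM; first exact: cvg_cst.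
  apply: cvgV; first by rewrite expf_neq0 // gt_eqF.
  exact: continuous_1m_sq.
- by move=> x /mI[x1 _]; rewrite mulr_ge0 ?ltW // divr_gt0 ?exprn_gt0.
- by move=> v /E_gt0 v0; exact: continuous_gamma_kernel.
- by move=> v /E_gt0 v0; rewrite ltW // gamma_kernel_gt0.
Qed.

Let continuous_substituted t u : 0 < u -> forall x, I x -> {for x, continuous
  (fun x => gamma_kernel t (u * ((1 + x) / (1 - x))) * (u * (2 / (1 - x) ^+ 2)))}.
Proof.
move=> u0 x Ix; have [x1 x2] := mI Ix.
apply: cvgM; last first.
  apply: cvgM; first exact: cvg_cst; apply: cvgM; first exact: cvg_cst.
  by apply: cvgV; [rewrite expf_neq0 // gt_eqF|exact: continuous_1m_sq].
apply: (@continuous_comp _ _ _ (fun x => u * ((1 + x) / (1 - x))) (gamma_kernel t)); last first.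
  by apply: continuous_gamma_kernel; rewrite mulr_gt0 // divr_gt0.
apply: cvgM; first exact: cvg_cst.
by apply: cvgM; [apply: cvgD; [exact: cvg_cst|exact: cvg_id]|exact: continuous_1mV].
Qed.

(** The powers [u^s] and [u^(-s)] cancel because the two arguments have a sum free of [s]; the
    parameter survives only in the factor depending on [x]. *)
Let kernel_product n s u x : 0 < u -> I x ->
  gamma_kernel (n.+1%:R + s) u *
    (gamma_kernel (n.+2%:R - s) (u * ((1 + x) / (1 - x))) * (u * (2 / (1 - x) ^+ 2)))
  = K n s u x.
Proof.
move=> u0 /mI[x1 x2].
have y0 : 0 < (1 + x) / (1 - x) by rewrite divr_gt0.
have lE : lnratio x = - ln ((1 + x) / (1 - x)).
  by rewrite /lnratio -invf_div lnV ?posrE.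
have eN (r v : R) m : 0 < v -> expR ((m%:R + r) * ln v) = v ^+ m * expR (r * ln v).
  by move=> v0; rewrite mulrDl expRD expRM_natl lnK ?posrE.
have e1 : expR (- (u * lam x)) = expR (- u) * expR (- (u * ((1 + x) / (1 - x)))).
  by rewrite -expRD; congr expR; rewrite /lam; field; rewrite gt_eqF.
rewrite /K /q /gamma_kernel e1 lE lnM ?posrE // mulrN -mulNr !(eN _ _ _ u0) mulrDr expRD.
rewrite (eN _ _ _ u0) (eN _ _ _ y0).
have := expR_gt0 (s * ln u).
rewrite (mulNr s (ln u)) (expRN (s * ln u)).
move: (expR _) (expR (- (u * _))) (expR (s * _)) (expR (- s * ln ((1 + x) / _))) => A B C D.
move: ((1 + x) / (1 - x)) y0 => y y0 C0.
rewrite !exprS mul2n -addnn exprD; field.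
by rewrite !gt_eqF.
Qed.

(* Tonelli, after substituting [v = u * (1 + x) / (1 - x)] in the integral of
   the second factor. *)
Lemma gamma_beta n s :
  (egamma (n.+1%:R + s) * egamma (n.+2%:R - s) =
   egamma (2 * n).+3%:R *
     \int[mu]_(x in I) (2 ^- (2 * n).+2 * ((1 - x ^+ 2) ^+ n * expweight s x))%:E)%E.
Proof.
have weight_gt0 x : I x -> 0 < (1 - x ^+ 2) ^+ n * expweight s x.
  move=> Ix; have [x1 x2] := mI Ix; rewrite mulr_gt0 ?expweight_gt0 // exprn_gt0 //; nra.
have mE : measurable E by exact: measurable_itv.
have mI' : measurable I by exact: measurable_itv.
(* Each one-variable factor is extended by zero, which makes [F] measurable on the whole plane; the
   first and the last factor make it vanish off the rectangle. *)
pose F (z : R * R) := ((fun u => u ^+ (2 * n).+2) \_ E) z.1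
  * expR (- (z.1 * (lam \_ I) z.2)) * (q n s \_ I) z.2.
have FE u x : F (u, x) = if (u \in E) && (x \in I) then K n s u x else 0.
  rewrite /F /= !patchE; case: (u \in E); last by rewrite !mul0r.
  by case: (x \in I); rewrite ?mulr0.
have F0 z : (0 <= (F z)%:E)%E.
  case: z => u x; rewrite FE lee_fin; case: ifPn => // /andP[].
  rewrite !inE => /E_gt0 u0 Ix.
  by rewrite /K mulr_ge0 ?q_ge0 // mulr_ge0 ?expR_ge0 // exprn_ge0 // ltW.
have mF : measurable_fun setT (EFin \o F).
  apply/measurable_EFinP; apply: measurable_funM; first apply: measurable_funM.
  - apply: (measurableT_comp (f := (fun u => u ^+ (2 * n).+2) \_ E)) => //.
    apply/(measurable_restrictT _ mE).
    apply: (exhaustion_measurable_fun (segment_exhaustion_0y R)) => u _.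
    exact: exprn_continuous.
  - apply: measurableT_comp => //; apply: measurableT_comp => //.
    apply: measurable_funM => //.
    apply: (measurableT_comp (f := lam \_ I)) => //.
    apply/(measurable_restrictT _ mI').
    apply: (exhaustion_measurable_fun (segment_exhaustion_oo R)); exact: continuous_lam.
  - apply: (measurableT_comp (f := q n s \_ I)) => //.
    by apply/(measurable_restrictT _ mI'); exact: measurable_q.
have := fubini_tonelli (m1 := mu) (m2 := mu) _ mF F0; rewrite /=.
rewrite (_ : (\int[mu]_x0 _ = egamma (n.+1%:R + s) * egamma (n.+2%:R - s))%E); last first.
  rewrite [X in (X * _)%E]/egamma -ge0_integralZr //; first last.
  - by rewrite ltW // egamma_gt0.
  - by move=> u /E_gt0 u0; rewrite lee_fin ltW // gamma_kernel_gt0.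
  - by apply/measurable_EFinP; exact: measurable_gamma_kernel.
  rewrite [RHS]integral_mkcond; apply: eq_integral => u _.
  rewrite patchE; case: ifPn => uE; last first.
    rewrite integral0_eq // => x _; by rewrite FE (negbTE uE).
  have u0 : 0 < u by apply: E_gt0; rewrite inE in uE.
  rewrite (egamma_substitution _ u0) -ge0_integralZl //; first last.
  - by rewrite lee_fin ltW // gamma_kernel_gt0.
  - move=> x /mI[x1 x2]; rewrite lee_fin ltW // mulr_gt0 //.
      by apply: gamma_kernel_gt0; rewrite mulr_gt0 // divr_gt0.
    by rewrite mulr_gt0 // divr_gt0 // exprn_gt0.
  - apply/measurable_EFinP; apply: (exhaustion_measurable_fun (segment_exhaustion_oo R)).
    exact: continuous_substituted.
  rewrite [RHS]integral_mkcond; apply: eq_integral => x _.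
  rewrite patchE FE uE /=; case: ifPn => // xI; rewrite inE in xI.
  by rewrite -EFinM kernel_product.
move=> ->; rewrite -ge0_integralZl //; first last.
- by rewrite ltW // egamma_gt0.
- by move=> x Ix; rewrite lee_fin mulr_ge0 ?invr_ge0 ?exprn_ge0 // ltW // weight_gt0.
- apply/measurable_EFinP; apply: (exhaustion_measurable_fun (segment_exhaustion_oo R)) => x Ix.
  apply: cvgM; first exact: cvg_cst.
  apply: cvgM; last exact: continuous_expweight.
  apply: (@continuous_comp _ _ _ (fun x : R => 1 - x ^+ 2) (fun y => y ^+ n)); last exact: exprn_continuous.
  by apply: cvgB; [exact: cvg_cst|exact: exprn_continuous].
rewrite [RHS]integral_mkcond; apply: eq_integral => x _.
rewrite patchE; case: ifPn => xI; last first.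
  rewrite integral0_eq // => u _; by rewrite FE (negbTE xI) andbF.
have Ix : I x by rewrite inE in xI.
have [x1 x2] := mI Ix.
(* In the other order of integration, the inner integral is a Gamma integral scaled by [lam x]. *)
transitivity (\int[mu]_(u in E) ((q n s x)%:E * (u ^+ (2 * n).+2 * expR (- (u * lam x)))%:E))%E.
  rewrite [RHS]integral_mkcond; apply: eq_integral => u _.
  rewrite patchE FE xI andbT; case: ifPn => // uE.
  by rewrite -EFinM /K mulrC.
have l0 : 0 < lam x by rewrite /lam divr_gt0.
rewrite ge0_integralZl //; first last.
- by rewrite lee_fin q_ge0.
- by move=> u /E_gt0 u0; rewrite lee_fin mulr_ge0 ?expR_ge0 ?exprn_ge0 // ltW.
- apply/measurable_EFinP; apply: (exhaustion_measurable_fun (segment_exhaustion_0y R)) => u _.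
  apply: cvgM; first exact: exprn_continuous.
  apply: (@continuous_comp _ _ _ (fun u => - (u * lam x)) expR); last exact: continuous_expR.
  by apply: cvgN; apply: cvgM; [exact: cvg_id|exact: cvg_cst].
rewrite egamma_scale // muleA [RHS]muleC; congr (_ * _)%E.
rewrite -EFinM; congr EFin.
rewrite /q /lam /expweight.
have -> : 1 - x ^+ 2 = (1 - x) * (1 + x) by ring.
move: (1 - x) (1 + x) (expR _) x1 x2 => P Q e P0 Q0.
rewrite !exprMn !exprVn !exprS !expr0 mul2n -addnn !exprD; field.
by rewrite ?expf_neq0 gt_eqF.
Qed.

End GammaBeta.

(** * Convergence and derivatives of the Gamma function *)

Section GammaFunction.
Variable R : realType.
Notation mu := (@lebesgue_measure R).
Implicit Types (x u t s : R) (n : nat).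

Local Notation I := (`]-1, 1[%classic : set R).
Local Notation E := (`]0, +oo[%classic : set R).

Let E_gt0 u : E u -> 0 < u. Proof. by rewrite /= in_itv /= andbT. Qed.

Let mE : measurable (E : set (measurableTypeR R)). Proof. exact: measurable_itv. Qed.
Let mI : measurable (I : set (measurableTypeR R)). Proof. exact: measurable_itv. Qed.

Lemma horner_1mX2X n x : (((1 - 'X^2) ^+ n : {poly R})).[x] = (1 - x ^+ 2) ^+ n.
Proof. by rewrite horner_exp !hornerE. Qed.

Lemma integrable_gamma_kernel_nat n : mu.-integrable E (EFin \o gamma_kernel n.+2%:R).
Proof.
(* From [(u/2)^(n+1) / (n+1)! <= exp (u/2)]: the power is absorbed at the cost of half of the
   exponential decay. *)
pose C : R := 2 ^+ n.+1 * n.+1`!%:R.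
have C0 : 0 < C by rewrite mulr_gt0 ?exprn_gt0 ?ltr0n ?fact_gt0.
have D u : is_derive u 1 (fun u => - (2 * C) * expR (u * - 2^-1)) (C * expR (u * - 2^-1)).
  have D := is_derive_expR_scaled (- (2 * C)) (- 2^-1) u.
  by apply: is_derive_eq; field.
apply: (@dominated_by_derivative_integrable _ _ _ _ (segment_exhaustion_0y R) _
  (fun u => - (2 * C) * expR (u * - 2^-1)) (fun u => C * expR (u * - 2^-1)) (2 * C)).
- by move=> u /E_gt0; exact: continuous_gamma_kernel.
- by move=> u /E_gt0 u0; exact/ltW/gamma_kernel_gt0.
- move=> u _; exact: is_derive_continuous (is_derive_expR_scaled C (- 2^-1) u).
- move=> u /E_gt0 u0; rewrite gamma_kernel_nat //.
  have u2 : 0 <= u / 2 by rewrite divr_ge0 // ltW.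
  have H := expR_ge1Dxn n u2.
  have -> : expR (- u) = expR (u * - 2^-1) * expR (u * - 2^-1).
    by rewrite -expRD; congr expR; field.
  rewrite mulrA ler_wpM2r ?expR_ge0 // mulrN expRN ler_pdivrMr ?expR_gt0 //.
  have -> : u ^+ n.+1 = C * ((u / 2) ^+ n.+1 / n.+1`!%:R).
    rewrite /C expr_div_n; field.
    by rewrite expf_neq0 ?pnatr_eq0 -?lt0n ?fact_gt0.
  rewrite ler_pM2l //; apply: le_trans H; rewrite lerDr //.
- move=> u /E_gt0 u0; have CC : 0 <= 2 * C by rewrite mulr_ge0 // ltW.
  have e1 : expR (u * - 2^-1) <= 1 by rewrite -expR0 ler_expR mulrN oppr_le0 divr_ge0 // ltW.
  by rewrite normrM normrN (ger0_norm CC) (ger0_norm (expR_ge0 _)) ler_piMr.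
Qed.

(* Both factors of the Beta integral are positive, so its finiteness bounds
   each of them. *)
Lemma egamma_lty t : 0 < t -> (egamma t < +oo)%E.
Proof.
(* This choice puts [s = t - (n + 1)] in the open interval from [-1] to [2], where the weight is
   integrable; the truncated predecessor also covers [t < 1]. *)
move=> t0; pose n := (Num.trunc t).-1.
have [nt tn] : n%:R < t /\ t < n.+3%:R.
  have /trunc_itv/andP[t1 t2] : 0 <= t by exact: ltW.
  split; last by rewrite (lt_le_trans t2) // ler_nat /n; lia.
  have [->|nt] := eqVneq n 0%N; first by [].
  by rewrite (lt_le_trans _ t1) // ltr_nat /n; lia.
pose s := t - n.+1%:R.
have [s1 s2] : -1 < s /\ s < 2.
  by rewrite /s -natr1; move: tn; rewrite -2!natr1 => tn; split; lra.
have := gamma_beta n s.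
have -> : n.+1%:R + s = t by rewrite /s subrKC.
set b := egamma (_ - s) => H.
have b0 : (0 < b)%E by exact: egamma_gt0.
have : (egamma t * b < +oo)%E.
  rewrite H lte_mul_pinfty //; first by rewrite ltW // egamma_gt0.
    by have := integrable_fin_num mE (integrable_gamma_kernel_nat (2 * n).+1).
  have iw := integrable_horner_expweight ((2 ^- (2 * n).+2) *: (1 - 'X^2) ^+ n) s1 s2.
  have := integrable_fin_num mI iw.
  rewrite fin_numElt => /andP[_]; apply: le_lt_trans; rewrite le_eqVlt; apply/orP; left.
  apply/eqP; apply: eq_integral => x _ /=; congr EFin.
  by rewrite hornerZ horner_1mX2X /expweight; ring.
have := egamma_gt0 t; case: (egamma t) => [e _ _|_|//]; first exact: ltry.
by rewrite gt0_mulye.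
Qed.

Lemma integrable_gamma_kernel t : 0 < t -> mu.-integrable E (EFin \o gamma_kernel t).
Proof.
move=> t0; apply/integrableP; split.
  apply/measurable_EFinP; apply: (exhaustion_measurable_fun (segment_exhaustion_0y R)) => u /E_gt0.
  exact: continuous_gamma_kernel.
apply: le_lt_trans (egamma_lty t0); rewrite le_eqVlt; apply/orP; left; apply/eqP.
apply: eq_integral => u; rewrite inE => /E_gt0 u0.
by rewrite /= ger0_norm // ltW // gamma_kernel_gt0.
Qed.

Lemma GammaE t : Gamma t = \int[mu]_(u in E) gamma_kernel t u.
Proof.
by apply: eq_Rintegral => u; rewrite inE => /E_gt0; exact: gamma_kernelE.
Qed.

Lemma EFin_Gamma t : 0 < t -> (Gamma t)%:E = egamma t.
Proof.
move=> t0; rewrite GammaE /Rintegral fineK //.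
by have := integrable_fin_num mE (integrable_gamma_kernel t0).
Qed.

Lemma Gamma_gt0 t : 0 < t -> 0 < Gamma t.
Proof. by move=> t0; rewrite -lte_fin EFin_Gamma // egamma_gt0. Qed.

Definition Gamma' t : R := \int[mu]_(u in E) (expR (- u) / u * ln u * expR (t * ln u)).

Definition Gamma'' t : R :=
  \int[mu]_(u in E) (expR (- u) / u * ln u * ln u * expR (t * ln u)).

Let measurable_ln_E : measurable_fun E (@ln R).
Proof. exact: measurable_funTS. Qed.

Lemma is_derive_Gamma t : 0 < t -> is_derive t 1 (@Gamma R) (Gamma' t).
Proof.
move=> t0; rewrite (_ : @Gamma R = fun t => \int[mu]_(u in E) gamma_kernel t u); last first.
  by apply/funext => r; exact: GammaE.
apply: (@exponential_family_is_derive _ _ _ mu E mE (fun u => expR (- u) / u) (@ln R) 0 (t + 1)) => //.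
- by move=> s s0 _; exact: integrable_gamma_kernel.
- by rewrite ltrDl.
Qed.

Lemma is_derive_Gamma' t : 0 < t -> is_derive t 1 Gamma' (Gamma'' t).
Proof.
move=> t0.
apply: (@exponential_family_is_derive _ _ _ mu E mE (fun u => expR (- u) / u * ln u) (@ln R) 0 (t + 1)) => //.
- move=> s s0 st.
  apply: (@exponential_family_integrable _ _ _ mu E mE (fun u => expR (- u) / u) (@ln R) 0 (t + 1)) => //.
  by move=> r r0 _; exact: integrable_gamma_kernel.
- by rewrite ltrDl.
Qed.

Lemma trigammaE t : 0 < t ->
  trigamma t = Gamma'' t / Gamma t - (Gamma' t / Gamma t) ^+ 2.
Proof.
move=> t0; rewrite /trigamma derive1nS derive1n1 derive1E.
have H : \near t, Gamma' t / Gamma t = (fun r => ln (Gamma r))^`()%classic t.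
  near=> r; have r0 : 0 < r by near: r; exact: lt_nbhsr.
  have D := @is_derive1_comp _ (@ln R) (@Gamma R) r _ _ (is_derive1_ln (Gamma_gt0 r0)) (is_derive_Gamma r0).
  by rewrite derive1E; apply/esym; rewrite mulrC; exact: derive_val.
have <- := @near_eq_derive R _ _ _ _ t (1 : R) H.
have D1 := is_derive_Gamma t0; have D2 := is_derive_Gamma' t0.
have G0 : Gamma t != 0 by rewrite gt_eqF // Gamma_gt0.
have D3 := @is_deriveV _ (@Gamma R) _ _ _ G0 D1.
have D4 := @is_deriveM _ _ Gamma' (fun r => (Gamma r)^-1) _ _ _ _ D2 D3.
rewrite (_ : (fun r => Gamma' r / Gamma r) = Gamma' * (fun r => (Gamma r)^-1)) //.
rewrite derive_val /GRing.scale /=; field; exact: G0.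
Unshelve. all: by end_near. Qed.

Lemma Gamma_beta n s : -1 < s -> s < 2 ->
  Gamma (n.+1%:R + s) * Gamma (n.+2%:R - s) =
  Gamma (2 * n).+3%:R * 2 ^- (2 * n).+2
   * \int[mu]_(x in I) (((1 - 'X^2) ^+ n).[x] * expweight s x).
Proof.
move=> s1 s2.
have iw := integrable_horner_expweight ((1 - 'X^2) ^+ n) s1 s2.
have iw2 : mu.-integrable I (EFin \o (fun x => ((1 - 'X^2) ^+ n).[x] * expweight s x)).
  by move: iw; congr (mu.-integrable _ _); apply/funext => x; rewrite /= /expweight mulrA.
rewrite -mulrA -RintegralZl //; apply: EFin_inj; rewrite !EFinM.
have t1 : 0 < n.+1%:R + s by rewrite -natr1 -addrA ltr_wpDl //; lra.
have t2 : 0 < n.+2%:R - s by rewrite -natr1 -natr1 -!addrA ltr_wpDl //; lra.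
rewrite !EFin_Gamma ?ltr0n // gamma_beta; congr (_ * _)%E.
rewrite /Rintegral fineK; last first.
  by have := integrable_fin_num mI (integrableZl mI (2 ^- (2 * n).+2) iw2).
by apply: eq_integral => x _; rewrite horner_1mX2X.
Qed.

End GammaFunction.

(** * Fisher information *)

Section Moments.
Variable R : realType.
Notation mu := (@lebesgue_measure R).
Implicit Types (x s t c : R) (p q : {poly R}) (n k : nat).

Local Notation I := (`]-1, 1[%classic : set R).

Let mI : measurable (I : set (measurableTypeR R)). Proof. exact: measurable_itv. Qed.

(* [moment k] is the [k]-th derivative of [moment 0] in [s]. *)
Definition moment k s p : R :=
  \int[mu]_(x in I) (p.[x] * (1 + x) * lnratio x ^+ k * expR (s * lnratio x)).

Lemma integrable_moment k s p : -1 < s -> s < 2 ->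
  mu.-integrable I (EFin \o (fun x =>
    p.[x] * (1 + x) * lnratio x ^+ k * expR (s * lnratio x))).
Proof.
elim: k s => [|k IH] s s1 s2.
  have := integrable_horner_expweight p s1 s2.
  by congr (mu.-integrable _ _); apply/funext => x; rewrite /= expr0 mulr1.
have := @exponential_family_integrable _ _ _ mu I mI
  (fun x => p.[x] * (1 + x) * lnratio x ^+ k) (@lnratio R) (-1) 2 (@measurable_lnratio R) IH s s1 s2.
by congr (mu.-integrable _ _); apply/funext => x; rewrite /= exprSr !mulrA.
Qed.

Lemma is_derive_moment k s p : -1 < s -> s < 2 ->
  is_derive s 1 (fun t => moment k t p) (moment k.+1 s p).
Proof.
move=> s1 s2.
have -> : moment k.+1 s p = \int[mu]_(x in I)
    (p.[x] * (1 + x) * lnratio x ^+ k * lnratio x * expR (s * lnratio x)).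
  by apply: eq_Rintegral => x _; rewrite exprSr !mulrA.
exact: (@exponential_family_is_derive _ _ _ mu I mI
  (fun x => p.[x] * (1 + x) * lnratio x ^+ k) (@lnratio R) (-1) 2
  (fun t => @integrable_moment k t p) s s1 s2).
Qed.

Lemma momentD k s p q : -1 < s -> s < 2 ->
  moment k s (p + q) = moment k s p + moment k s q.
Proof.
move=> s1 s2; rewrite /moment -RintegralD //; try exact: integrable_moment.
by apply: eq_Rintegral => x _; rewrite hornerD !mulrDl.
Qed.

Lemma momentZ k s c p : -1 < s -> s < 2 -> moment k s (c *: p) = c * moment k s p.
Proof.
move=> s1 s2; rewrite /moment -RintegralZl //; try exact: integrable_moment.
by apply: eq_Rintegral => x _; rewrite hornerZ !mulrA.
Qed.

Lemma moment0E s p : moment 0 s p = \int[mu]_(x in I) (p.[x] * expweight s x).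
Proof. by apply: eq_Rintegral => x _; rewrite expr0 mulr1 mulrA. Qed.

Lemma moment0_1_gt0 s : -1 < s -> s < 2 -> 0 < moment 0 s 1.
Proof.
move=> s1 s2; rewrite moment0E /Rintegral -lte_fin fineK; last first.
  have := integrable_fin_num mI (integrable_expweight s1 s2).
  by congr (_ \is a fin_num); apply: eq_integral => x _; rewrite hornerC mul1r.
apply: (exhaustion_integral_gt0 (segment_exhaustion_oo R)) => x Ix.
  apply: cvgM; [exact: continuous_horner|exact: continuous_expweight].
by rewrite hornerC mul1r expweight_gt0.
Qed.

Lemma is_derive_horner p x : is_derive x 1 (horner p) p^`().[x].
Proof.
by split; [exact: derivable_horner|rewrite -derive1E -derivE].
Qed.

Lemma cvg_expR_ln_inv_nat (k : R) : 0 < k ->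
  expR (k * ln (n.+2%:R^-1)) @[n --> \oo] --> (0 : R).
Proof.
move=> k0; have /cvg_at_rightP H := powR_cvg0 k0.
have e0 n : 0 < (n.+2%:R^-1 : R) by rewrite invr_gt0 ltr0n.
have := H (fun n => n.+2%:R^-1) (conj e0 _).
have -> : (fun n => (n.+2%:R^-1 : R) `^ k) = (fun n => expR (k * ln (n.+2%:R^-1))).
  by apply/funext => n; rewrite /powR gt_eqF.
by apply; have := @cvg_harmonic R; rewrite -cvg_shiftS.
Qed.

(** The integrand is the derivative of [F = (1 - x)^(s+1) (1 + x)^(2-s) p], which tends to [0] at
    both ends because the exponents are positive. This provides the hypothesis [l_pearson] for the
    integral functional. *)
Lemma moment0_pearson s p : -1 < s -> s < 2 -> moment 0 s (pearson s p) = 0.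
Proof.
move=> s1 s2.
pose b (r c x : R) := expR (r * ln (1 + c * x)).
have mb x : I x -> 0 < 1 + -1 * x /\ 0 < 1 + 1 * x.
  by rewrite /= in_itv /= => /andP[? ?]; split; lra.
pose F x := b (s + 1) (-1) x * b (2 - s) 1 x * p.[x].
pose e n : R := n.+2%:R^-1.
have cpw x : I x -> {for x, continuous (fun x => (pearson s p).[x] * expweight s x)}.
  by move=> Ix; apply: cvgM; [exact: continuous_horner|exact: continuous_expweight].
have dF x : I x -> is_derive x 1 F ((pearson s p).[x] * expweight s x).
  move=> Ix; have [x1 x2] := mb _ Ix.
  have D1 := is_derive_expR_ln_affine (s + 1) x1.
  have D2 := is_derive_expR_ln_affine (2 - s) x2.
  have D3 := is_derive_horner p x.
  have D12 := is_deriveM D1 D2; have D := is_deriveM D12 D3.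
  rewrite (_ : F = ((b (s + 1) (-1) : R -> R) * b (2 - s) 1 * horner p)) //.
  apply: is_derive_eq; rewrite /GRing.scale /= expweight_expR //.
  have Hp : (pearson s p).[x] = (1 - x ^+ 2) * p^`().[x] + (1 - 2 * s - 3 * x) * p.[x].
    by rewrite /pearson !hornerE.
  have bS r c : 0 < 1 + c * x -> expR ((r + 1) * ln (1 + c * x)) = expR (r * ln (1 + c * x)) * (1 + c * x).
    by move=> x0; rewrite mulrDl mul1r expRD lnK.
  have E2 : 2 - s = 1 - s + 1 by ring.
  rewrite fctE /= E2 !bS // Hp.
  move: (expR _) (expR _) => u v; field.
  by rewrite mulN1r mul1r in x1 x2 *; rewrite !gt_eqF.
have s10 : 0 < s + 1 by lra.
have s20 : 0 < 2 - s by lra.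
have ce : e n @[n --> \oo] --> 0 by have := @cvg_harmonic R; rewrite -cvg_shiftS.
have c2e : 2 - e n @[n --> \oo] --> (2 : R).
  by rewrite -[X in _ --> X]subr0; apply: cvgB => //; exact: cvg_cst.
have cb (r : R) : expR (r * ln (2 - e n)) @[n --> \oo] --> expR (r * ln 2).
  apply: continuous_cvg; first exact: continuous_expR.
  apply: cvgM; first exact: cvg_cst.
  by apply: continuous_cvg => //; exact: continuous_ln.
have cp (u : nat -> R) z : u n @[n --> \oo] --> z -> p.[u n] @[n --> \oo] --> p.[z].
  by move=> uz; apply: continuous_cvg => //; exact: continuous_horner.
rewrite moment0E (@exhaustion_FTC _ _ _ _ (segment_exhaustion_oo R) F _ 0 0) ?subrr //.
- have := integrable_moment 0 (pearson s p) s1 s2.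
  by congr (mu.-integrable _ _); apply/funext => x; rewrite /= expr0 mulr1 mulrA.
- have -> : (fun n => F (-1 + n.+2%:R^-1)) =
      (fun n => expR ((s + 1) * ln (2 - e n)) * expR ((2 - s) * ln (e n)) * p.[-1 + e n]).
    apply/funext => n; rewrite /F /b -/(e n).
    by congr (expR (_ * ln _) * expR (_ * ln _) * _); ring.
  rewrite -(mul0r p.[-1 + 0]); apply: cvgM; last first.
    by apply: cp; apply: cvgD => //; exact: cvg_cst.
  rewrite -(mulr0 (expR ((s + 1) * ln 2))); apply: cvgM; first exact: cb.
  exact: cvg_expR_ln_inv_nat.
- have -> : (fun n => F (1 - n.+2%:R^-1)) =
      (fun n => expR ((s + 1) * ln (e n)) * expR ((2 - s) * ln (2 - e n)) * p.[1 - e n]).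
    apply/funext => n; rewrite /F /b -/(e n).
    by congr (expR (_ * ln _) * expR (_ * ln _) * _); ring.
  rewrite -(mul0r p.[1 - 0]); apply: cvgM; last first.
    by apply: cp; apply: cvgB => //; exact: cvg_cst.
  rewrite -(mul0r (expR ((2 - s) * ln 2))); apply: cvgM; last exact: cb.
  exact: cvg_expR_ln_inv_nat.
Qed.

End Moments.

(** * Differentiating polynomials in a parameter *)

Section PolyDerive.
Variable R : realType.
Implicit Types (P Q : R -> {poly R}) (s t : R) (p q dP dQ : {poly R}).

(** Coefficientwise derivative; the uniform degree bound makes every linear functional of [P t] a
    sum over a fixed finite set of monomials. *)
Definition poly_is_derive P s dP :=
  (exists N, forall t, (size (P t) <= N)%N) /\
  forall i, is_derive s 1 (fun t => (P t)`_i) dP`_i.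

Lemma poly_is_derive_unique P s dP dQ :
  poly_is_derive P s dP -> poly_is_derive P s dQ -> dP = dQ.
Proof.
move=> [_ D1] [_ D2]; apply/polyP => i; have d1 := D1 i; have d2 := D2 i.
by rewrite -[LHS](@derive_val _ _ _ _ _ _ _ d1) -[RHS](@derive_val _ _ _ _ _ _ _ d2).
Qed.

Lemma poly_is_derive_cst p s : poly_is_derive (fun=> p) s 0.
Proof.
split; first by exists (size p).
by move=> i; rewrite coef0; exact: is_derive_cst.
Qed.

Lemma poly_is_deriveD P Q s dP dQ : poly_is_derive P s dP -> poly_is_derive Q s dQ ->
  poly_is_derive (fun t => P t + Q t) s (dP + dQ).
Proof.
move=> [[N NP] D1] [[M MQ] D2]; split.
  exists (maxn N M) => t; rewrite (leq_trans (size_polyD _ _)) // geq_max.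
  by rewrite (leq_trans (NP t)) ?leq_maxl // (leq_trans (MQ t)) ?leq_maxr.
move=> i; rewrite coefD (_ : (fun t => _) = (fun t => (P t)`_i) + (fun t => (Q t)`_i)).
  exact: is_deriveD.
by apply/funext => t; rewrite coefD.
Qed.

Lemma poly_is_deriveM P Q s dP dQ : poly_is_derive P s dP -> poly_is_derive Q s dQ ->
  poly_is_derive (fun t => P t * Q t) s (P s * dQ + dP * Q s).
Proof.
move=> [[N NP] D1] [[M MQ] D2]; split.
  exists (N + M)%N => t; rewrite (leq_trans (size_polyMleq _ _)) //.
  by rewrite (leq_trans (leq_pred _)) // leq_add.
move=> i; rewrite coefD !coefM -big_split /=.
rewrite (_ : (fun t => _) = \sum_(j < i.+1) (fun t => (P t)`_j * (Q t)`_(i - j))); last first.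
  by apply/funext => t; rewrite coefM fct_sumE.
apply: is_derive_sum => j; have d1 := D1 j; have d2 := D2 (i - j)%N.
have D := is_deriveM d1 d2.
by apply: is_derive_eq; rewrite /GRing.scale /=; ring.
Qed.

Lemma poly_is_deriveZ (c : R -> R) s dc p : is_derive s 1 c dc ->
  poly_is_derive (fun t => c t *: p) s (dc *: p).
Proof.
move=> D; split; first by exists (size p) => t; exact: size_scale_leq.
move=> i; rewrite coefZ (_ : (fun t => _) = (fun t => p`_i * c t)); last first.
  by apply/funext => t; rewrite coefZ mulrC.
have D2 := is_deriveZ p`_i D.
by apply: is_derive_eq; rewrite /GRing.scale /= mulrC.
Qed.

Lemma poly_is_derive_sum n (P : 'I_n -> R -> {poly R}) s (dP : 'I_n -> {poly R}) :
  (forall i, poly_is_derive (P i) s (dP i)) ->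
  poly_is_derive (fun t => \sum_i P i t) s (\sum_i dP i).
Proof.
elim: n P dP => [|n IH] P dP D.
  under eq_fun do rewrite big_ord0.
  by rewrite big_ord0; exact: poly_is_derive_cst.
under eq_fun do rewrite big_ord_recr.
by rewrite big_ord_recr /=; apply: poly_is_deriveD => //; exact: IH.
Qed.

Lemma poly_is_derive_deriv P s dP : poly_is_derive P s dP ->
  poly_is_derive (fun t => (P t)^`()) s dP^`().
Proof.
move=> [[N NP] D]; split.
  exists N => t; apply/leq_sizeP => j Nj.
  by rewrite coef_deriv nth_default ?mul0rn // (leq_trans (NP t)) // ltnW.
move=> i; have d := D i.+1; rewrite coef_deriv -mulr_natl.
rewrite (_ : (fun t => _) = i.+1%:R \*: (fun t => (P t)`_i.+1)); last first.
  by apply/funext => t; rewrite coef_deriv -[LHS]mulr_natl.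
exact: is_deriveZ.
Qed.

(** Product rule for the pairing of a varying functional with a varying polynomial, obtained by
    expanding over finitely many monomials. Linearity is asked only near [s], since the moments are
    known to be linear only for parameters in the admissible range. *)
Lemma poly_is_derive_functional (l : R -> {poly R} -> R) (l1 : {poly R} -> R) P s dP :
  (\forall t \near s, forall c p q, l t (c *: p + q) = c * l t p + l t q) ->
  (forall c p q, l1 (c *: p + q) = c * l1 p + l1 q) ->
  (forall p, is_derive s 1 (fun t => l t p) (l1 p)) ->
  poly_is_derive P s dP ->
  is_derive s 1 (fun t => l t (P t)) (l1 (P s) + l s dP).
Proof.
move=> linl linl1 D [[N NP] DP].
have lsum (f : {poly R} -> R) : (forall c p q, f (c *: p + q) = c * f p + f q) ->
    forall p, (size p <= N)%N -> f p = \sum_(i < N) p`_i * f 'X^i.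
  move=> lin p sp.
  have f0 : f 0 = 0 by have := lin (-1) 0 0; rewrite scaler0 add0r mulN1r addNr.
  have -> : f p = f (\sum_(i < N) p`_i *: 'X^i).
    congr f; apply/polyP => i; rewrite coef_sum.
    have [iN|Ni] := ltnP i N.
      rewrite (bigD1 (Ordinal iN)) //= coefZ coefXn eqxx mulr1 big1 ?addr0 // => j ji.
      rewrite coefZ coefXn [(i == _)](_ : _ = false) ?mulr0 //.
      by apply/negbTE; apply: contra ji => /eqP ij; apply/eqP/val_inj.
    rewrite nth_default ?(leq_trans sp) // big1 // => j _.
    by rewrite coefZ coefXn gtn_eqF ?mulr0 // (leq_trans (ltn_ord j)).
  elim/big_ind2: _ => // [x1 p1 x2 p2 E1 E2|i _].
    by have := lin 1 p1 p2; rewrite scale1r mul1r E1 E2.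
  by have := lin p`_i 'X^i 0; rewrite addr0 f0 addr0.
have linls := nbhs_singleton linl.
have sdP : (size dP <= N)%N.
  apply/leq_sizeP => j Nj; have d := DP j.
  rewrite -[LHS](@derive_val _ _ _ _ _ _ _ d) (_ : (fun t => _) = cst 0) ?derive_cst //.
  by apply/funext => t; rewrite nth_default // (leq_trans (NP t)).
apply: (@near_eq_is_derive _ _ _ (\sum_(i < N) (fun t => (P t)`_i * l t 'X^i))).
  near=> t; rewrite fct_sumE (lsum (l t)) //.
  by near: t.
rewrite (lsum l1) // (lsum (l s)) // -big_split /=.
apply: is_derive_sum => i; have d1 := DP i; have d2 := D 'X^i.
have d := is_deriveM d1 d2.
by apply: is_derive_eq; rewrite /GRing.scale /=; ring.
Unshelve. all: by end_near. Qed.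

(** Evaluation at [x] is a functional that does not vary with [s], so its own derivative is [0]. *)
Lemma poly_is_derive_horner P s dP x : poly_is_derive P s dP ->
  is_derive s 1 (fun t => (P t).[x]) dP.[x].
Proof.
move=> DP.
have lin : \forall t \near s, forall c p q, (c *: p + q).[x] = c * p.[x] + q.[x].
  by near=> t => c p q; rewrite hornerD hornerZ.
have lin0 (c : R) (p q : {poly R}) : (0 : R) = c * 0 + 0 by rewrite mulr0 addr0.
have D p : is_derive s 1 (fun=> p.[x]) 0 by exact: is_derive_cst.
have := @poly_is_derive_functional (fun _ p => p.[x]) (fun=> 0) P s dP lin lin0 D DP.
by rewrite add0r.
Unshelve. all: by end_near. Qed.

Lemma derivable_pochhammer c m s : derivable (fun t : R => pochhammer (t + c) m) s 1.
Proof.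
elim: m => [|m IH].
  rewrite (_ : (fun t => _) = cst 1) ?derivable_cst //.
  by apply/funext => t; rewrite pochhammer0.
rewrite (_ : (fun t => _) = (fun t => pochhammer (t + c) m) * (fun t => t + (c + m%:R))).
  by apply: derivableM => //; exact: ex_derive.
by apply/funext => t; rewrite pochhammerS -addrA.
Qed.

Lemma poly_is_derive_grosjean2 n s :
  exists dg, poly_is_derive (grosjean2 n : R -> {poly R}) s dg.
Proof.
(* Since [a + b = 1], each term becomes one Pochhammer symbol in [a] times a fixed polynomial. *)
rewrite (_ : (grosjean2 n : R -> {poly R}) = (fun a => \sum_(l < n.+1)
   pochhammer (a + (l%:R + 1)) (n - l) *: ((2 ^+ n / 'C(2 * n + 1, n)%:R)
    *: ((pochhammer (n%:R + 2) l / (l`! * (n - l)`!)%:R) *: (2^-1 *: ('X - 1)) ^+ l)))); last first.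
  apply/funext => a; rewrite /grosjean2 /jacobi scaler_sumr; apply: eq_bigr => l _.
  rewrite !scalerA; congr (_ *: _).
  have -> : n%:R + a + (1 - a) + 1 = n%:R + 2 by ring.
  have -> : a + l%:R + 1 = a + (l%:R + 1) by ring.
  by move: (_ %:R)^-1 => f; ring.
eexists; apply: poly_is_derive_sum => l; apply: poly_is_deriveZ.
exact/derivableP/derivable_pochhammer.
Qed.

End PolyDerive.

(** * Evaluation of the Fisher information *)

Section Fisher.
Variables (R : realType) (n : nat).
Notation mu := (@lebesgue_measure R).
Implicit Types (s t x : R) (p q : {poly R}).

Local Notation I := (`]-1, 1[%classic : set R).
Let mI : measurable (I : set (measurableTypeR R)). Proof. exact: measurable_itv. Qed.

Local Notation g s := (grosjean2 n s : {poly R}).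
Let h s : R := moment 0 s (g s ^+ 2).

Let I_gt0 x : I x -> 0 < 1 + x.
Proof. by rewrite /= in_itv /= => /andP[? _]; lra. Qed.

Let near_range s : -1 < s -> s < 2 -> \forall t \near s, -1 < t /\ t < 2.
Proof.
move=> s1 s2; have H : \forall t \near s, t \in `]-1, 2[%R.
  by apply: near_in_itvoo; rewrite in_itv /= s1.
by near=> t; apply/andP; have : t \in `]-1, 2[%R by near: t.
Unshelve. all: by end_near. Qed.

Let h_gt0 s : -1 < s -> s < 2 -> 0 < h s.
Proof.
move=> s1 s2; apply: (@grosjean2_sq_norm_gt0 _ s (moment 0 s)) => //.
- by move=> p q; exact: momentD.
- by move=> c p; exact: momentZ.
- by move=> p; exact: moment0_pearson.
- exact: moment0_1_gt0.
Qed.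

Let moment_orthogonal s q : -1 < s -> s < 2 -> (size q <= n)%N ->
  moment 0 s (g s * q) = 0.
Proof.
move=> s1 s2; apply: grosjean2_orthogonal => //.
- by move=> p p'; exact: momentD.
- by move=> c p; exact: momentZ.
- by move=> p; exact: moment0_pearson.
Qed.

Let is_derive_moment_poly k s (P : R -> {poly R}) dP : -1 < s -> s < 2 ->
  poly_is_derive P s dP ->
  is_derive s 1 (fun t => moment k t (P t)) (moment k.+1 s (P s) + moment k s dP).
Proof.
move=> s1 s2; apply: poly_is_derive_functional.
- near=> t => c p q.
  have [t1 t2] : -1 < t /\ t < 2 by near: t; exact: near_range.
  by rewrite momentD // momentZ.
- by move=> c p q; rewrite momentD // momentZ.
- by move=> p; exact: is_derive_moment.
Unshelve. all: by end_near. Qed.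

(** Free of [s], hence it cancels in the logarithmic derivatives of the squared norm. *)
Let kappa : R := (grosjean2_scale R n / n.+1%:R) ^+ 2 / beta_ratio n
  / (Gamma (2 * n).+3%:R * 2 ^- (2 * n).+2).

Let h_Gamma s : -1 < s -> s < 2 ->
  h s = kappa * (Gamma (n.+1%:R + s) * Gamma (n.+2%:R - s)).
Proof.
move=> s1 s2; rewrite Gamma_beta // -moment0E.
have G0 : Gamma (2 * n).+3%:R * 2 ^- (2 * n).+2 != 0 :> R.
  by rewrite mulf_neq0 ?invr_eq0 ?expf_neq0 // gt_eqF // Gamma_gt0 // ltr0n.
rewrite /h (@grosjean2_sq_norm_1mX2 _ s (moment 0 s)) //.
- by rewrite /kappa mulrA divfK.
- by move=> p q; exact: momentD.
- by move=> c p; exact: momentZ.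
- by move=> p; exact: moment0_pearson.
Qed.

Let kappa_gt0 : 0 < kappa.
Proof.
apply: divr_gt0.
  by rewrite divr_gt0 ?beta_ratio_gt0 // exprn_gt0 // divr_gt0 ?grosjean2_scale_gt0.
by apply: mulr_gt0; [rewrite Gamma_gt0 // ltr0n|rewrite invr_gt0 exprn_gt0].
Qed.

Let args_gt0 s : -1 < s -> s < 2 -> 0 < n.+1%:R + s /\ 0 < n.+2%:R - s.
Proof.
move=> s1 s2; rewrite -!natr1; have : 0 <= n%:R :> R by [].
by move=> n0; split; lra.
Qed.

Let is_derive_shift (f f' : R -> R) s c : is_derive (c + s) 1 f (f' (c + s)) ->
  is_derive s 1 (fun t => f (c + t)) (f' (c + s)).
Proof.
move=> D; have D1 : is_derive s 1 (fun t => c + t) 1.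
  by apply: is_derive_eq; rewrite add0r ?mulr1.
have D2 := @is_derive1_comp _ f (fun t => c + t) _ _ _ D D1.
by apply: is_derive_eq; rewrite mulr1.
Qed.

Let is_derive_reflect (f f' : R -> R) s c : is_derive (c - s) 1 f (f' (c - s)) ->
  is_derive s 1 (fun t => f (c - t)) (- f' (c - s)).
Proof.
move=> D; have D1 : is_derive s 1 (fun t : R => c - t) (-1).
  by apply: is_derive_eq; rewrite add0r mul1r.
have D2 := @is_derive1_comp _ f (fun t => c - t) _ _ _ D D1.
by apply: is_derive_eq; rewrite mulrN1.
Qed.

Let is_derive_product_difference k (f1 f2 f3 f4 : R -> R) d1 d2 d3 d4 s :
  is_derive s 1 f1 d1 -> is_derive s 1 f2 d2 -> is_derive s 1 f3 d3 -> is_derive s 1 f4 d4 ->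
  is_derive s 1 (fun t => k * (f1 t * f2 t - f3 t * f4 t))
    (k * (d1 * f2 s + f1 s * d2 - (d3 * f4 s + f3 s * d4))).
Proof.
move=> D1 D2 D3 D4.
rewrite (_ : (fun t => _) = k \*: (f1 * f2 - f3 * f4)) //.
have d := is_deriveZ k (is_deriveB (is_deriveM D1 D2) (is_deriveM D3 D4)).
by apply: is_derive_eq; rewrite /GRing.scale /=; ring.
Qed.

(** The left-hand side is the second derivative of [ln h]. The derivatives [h1] and [h2], supplied
    later by moments, must agree with [k1] and [k2], computed from the Gamma product, by uniqueness
    of derivatives. *)
Let log_derivative2 (h1 : R -> R) h2 s : -1 < s -> s < 2 ->
  (forall t, -1 < t -> t < 2 -> is_derive t 1 h (h1 t)) -> is_derive s 1 h1 h2 ->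
  h2 / h s - (h1 s / h s) ^+ 2 = trigamma (n%:R + 2 - s) + trigamma (n%:R + s + 1).
Proof.
move=> s1 s2 D1 D2.
pose A t := n.+1%:R + t : R; pose B t := n.+2%:R - t : R.
pose k1 t := kappa * (Gamma' (A t) * Gamma (B t) - Gamma (A t) * Gamma' (B t)).
pose k2 := kappa * (Gamma'' (A s) * Gamma (B s) - 2 * (Gamma' (A s) * Gamma' (B s))
                    + Gamma (A s) * Gamma'' (B s)).
have dA t : -1 < t -> t < 2 -> is_derive t 1 (fun t => Gamma (A t)) (Gamma' (A t)).
  by move=> t1 t2; have [A0 _] := args_gt0 t1 t2; exact: is_derive_shift (is_derive_Gamma A0).
have dA' t : -1 < t -> t < 2 -> is_derive t 1 (fun t => Gamma' (A t)) (Gamma'' (A t)).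
  by move=> t1 t2; have [A0 _] := args_gt0 t1 t2; exact: is_derive_shift (is_derive_Gamma' A0).
have dB t : -1 < t -> t < 2 -> is_derive t 1 (fun t => Gamma (B t)) (- Gamma' (B t)).
  by move=> t1 t2; have [_ B0] := args_gt0 t1 t2; exact: is_derive_reflect (is_derive_Gamma B0).
have dB' t : -1 < t -> t < 2 -> is_derive t 1 (fun t => Gamma' (B t)) (- Gamma'' (B t)).
  by move=> t1 t2; have [_ B0] := args_gt0 t1 t2; exact: is_derive_reflect (is_derive_Gamma' B0).
have hk t : -1 < t -> t < 2 -> is_derive t 1 h (k1 t).
  move=> t1 t2; apply: (@near_eq_is_derive _ _ _
      (kappa \*: ((fun t => Gamma (A t)) * (fun t => Gamma (B t))))).
    near=> u; have [u1 u2] : -1 < u /\ u < 2 by near: u; exact: near_range.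
    by rewrite (h_Gamma u1 u2).
  have d1 := dA _ t1 t2; have d2 := dB _ t1 t2.
  have d := is_deriveZ kappa (is_deriveM d1 d2).
  apply: is_derive_eq; rewrite /k1 /GRing.scale /=.
  by move: kappa (Gamma _) (Gamma _) (Gamma' _) (Gamma' _) => k x1 x2 x3 x4; ring.
have Ek t : -1 < t -> t < 2 -> h1 t = k1 t.
  move=> t1 t2; have d1 := D1 _ t1 t2; have d2 := hk _ t1 t2.
  by rewrite -[LHS](@derive_val _ _ _ _ _ _ _ d1) -[RHS](@derive_val _ _ _ _ _ _ _ d2).
have Dk1 : is_derive s 1 k1 k2.
  have d := is_derive_product_difference kappa (dA' _ s1 s2) (dB _ s1 s2) (dA _ s1 s2) (dB' _ s1 s2).
  apply: is_derive_eq; rewrite /k2.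
  move: kappa (Gamma (A s)) (Gamma (B s)) (Gamma' (A s)) (Gamma' (B s)) => k x1 x2 x3 x4.
  by move: (Gamma'' (A s)) (Gamma'' (B s)) => x5 x6; ring.
have Ek2 : h2 = k2.
  rewrite -[LHS](@derive_val _ _ _ _ _ _ _ D2) -[RHS](@derive_val _ _ _ _ _ _ _ Dk1).
  apply: near_eq_derive; near=> t.
  have [t1 t2] : -1 < t /\ t < 2 by near: t; exact: near_range.
  exact: Ek.
have [A0 B0] := args_gt0 s1 s2.
rewrite Ek2 Ek // h_Gamma // -/(A s) -/(B s).
have -> : n%:R + 2 - s = B s by rewrite /B -!natr1; ring.
have -> : n%:R + s + 1 = A s by rewrite /A -!natr1; ring.
rewrite !trigammaE // /k1 /k2.
have /lt0r_neq0 := Gamma_gt0 A0; have /lt0r_neq0 := Gamma_gt0 B0; have /lt0r_neq0 := kappa_gt0.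
rewrite -/(A s) -/(B s); move: (Gamma'' (A s)) (Gamma'' (B s)) (Gamma' (A s)) (Gamma' (B s)).
move: kappa (Gamma (A s)) (Gamma (B s)) => k x1 x2 x3 x4 x5 x6 k0 b0 a0.
by field; rewrite k0 b0 a0.
Unshelve. all: by end_near. Qed.

(** The number [k] is half the logarithmic derivative of the squared norm, brought in by the
    normalisation. In the expanded square the two contributions of [dg ^+ 2] cancel, leaving a
    quarter of the variance of [lnratio] under the probability density [g^2 w / h]. *)
Let fisher_integral s (k : R) (dg : {poly R}) :
  -1 < s -> s < 2 -> (size dg <= n)%N ->
  moment 1 s (g s * dg) = - moment 0 s (dg ^+ 2) ->
  k = moment 1 s (g s ^+ 2) / (2 * h s) ->
  (\int[mu]_(x in I) ((expweight s x / h s *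
      (lnratio x / 2 * (g s).[x] + dg.[x] - k * (g s).[x]) ^+ 2)%:E))%E =
   ((moment 2 s (g s ^+ 2) / h s - (moment 1 s (g s ^+ 2)) ^+ 2 / h s ^+ 2) / 4)%:E.
Proof.
move=> s1 s2 sdg m1 kE; have h0 := lt0r_neq0 (h_gt0 s1 s2).
pose q := dg - k *: g s.
pose F j p x := p.[x] * (1 + x) * lnratio x ^+ j * expR (s * lnratio x).
have intF j p : mu.-integrable I (EFin \o F j p) by exact: integrable_moment.
have intZ j c p : mu.-integrable I (EFin \o (fun x => c * F j p x)).
  by have := integrableZl mI c (intF j p).
have intD f1 f2 : mu.-integrable I (EFin \o f1) -> mu.-integrable I (EFin \o f2) ->
    mu.-integrable I (EFin \o (fun x => f1 x + f2 x)).
  by move=> i1 i2; have := integrableD mI i1 i2.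
pose T x := (h s)^-1 * 4^-1 * F 2%N (g s ^+ 2) x + ((h s)^-1 * F 1%N (g s * q) x + (h s)^-1 * F 0%N (q ^+ 2) x).
have i2 := intZ 2%N ((h s)^-1 * 4^-1) (g s ^+ 2).
have i1 := intZ 1%N (h s)^-1 (g s * q).
have i0 := intZ 0%N (h s)^-1 (q ^+ 2).
have i10 := intD _ _ i1 i0.
have intT : mu.-integrable I (EFin \o T) by have := intD _ _ i2 i10.
transitivity (\int[mu]_(x in I) (T x)%:E)%E.
  apply: eq_integral => x _; congr EFin.
  rewrite /T /F /q /expweight; move: (h s) h0 (g s) => H H0 G.
  rewrite !(hornerM, horner_exp, hornerD, hornerN, hornerZ) expr0 expr1.
  by move: (expR (s * lnratio x)) (lnratio x) G.[x] dg.[x] => e L u v; field.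
rewrite -[LHS]fineK; last by have := integrable_fin_num mI intT.
congr EFin; rewrite -/(Rintegral mu I T) /T.
rewrite (RintegralD mI i2 i10) (RintegralD mI i1 i0) !(RintegralZl _ mI (intF _ _)).
rewrite -/(moment 2 s _) -/(moment 1 s _) -/(moment 0 s _).
have -> : moment 1 s (g s * q) = - moment 0 s (dg ^+ 2) - k * moment 1 s (g s ^+ 2).
  have -> : g s * q = g s * dg + (- k) *: (g s ^+ 2).
    by rewrite /q -!mul_polyC polyCN; ring.
  by rewrite momentD // momentZ // m1 mulNr.
have -> : moment 0 s (q ^+ 2) = moment 0 s (dg ^+ 2) + k ^+ 2 * h s.
  have -> : q ^+ 2 = dg ^+ 2 + (- (2 * k)) *: (g s * dg) + (k ^+ 2) *: (g s ^+ 2).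
    by rewrite /q -!mul_polyC polyCN polyCM polyC_natr polyC_exp; ring.
  by rewrite momentD // momentD // !momentZ // moment_orthogonal // mulr0 addr0.
rewrite kE; move: (moment 0 s (dg ^+ 2)) (moment 1 s _) (moment 2 s _) (h s) h0 => D0 M1 M2 H H0.
by field.
Qed.

Lemma grosjean2_fisherE (a : R) : -1 < a -> a < 2 ->
  grosjean2_fisher n a =
    (8 * \sum_(0 <= k < n)
           (k.+1%:R ^+ 2 / ((n - k)%:R ^+ 2 * (n + k + 2)%:R ^+ 2)
            * ((pochhammer (k%:R + 2 - a) (n - k)
                - (-1) ^+ (n - k) * pochhammer (k%:R + a + 1) (n - k)) ^+ 2
               / (pochhammer (k%:R + a + 1) (n - k)
                  * pochhammer (k%:R + 2 - a) (n - k))))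
     + trigamma (n%:R + 2 - a) + trigamma (n%:R + a + 1))%:E.
Proof.
move=> a1 a2.
have /choice[dg dgP] : forall s : R, exists dg : {poly R}, poly_is_derive (grosjean2 n) s dg.
  exact: poly_is_derive_grosjean2.
have size_dg s : (size (dg s) <= n)%N.
  apply/leq_sizeP => j nj; have d := (dgP s).2 j.
  rewrite -[LHS](@derive_val _ _ _ _ _ _ _ d).
  have -> : (fun t : R => (g t)`_j) = cst (j == n)%:R.
    apply/funext => t; have [->|jn] := eqVneq j n.
      by rewrite -[n in _`_n]/(n.+1.-1) -(size_grosjean2 n t) -lead_coefE (monicP (grosjean2_monic _ _)).
    by rewrite nth_default // size_grosjean2 ltn_neqAle eq_sym jn.
  exact: derive_cst.
have dh t : -1 < t -> t < 2 -> is_derive t 1 h (moment 1 t (g t ^+ 2)).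
  move=> t1 t2; have P := poly_is_deriveM (dgP t) (dgP t).
  have d := is_derive_moment_poly 0 t1 t2 P.
  apply: is_derive_eq; rewrite momentD // [dg t * _]mulrC moment_orthogonal //.
  by rewrite !addr0 expr2.
(* The polynomial [dg a] is held fixed while the parameter of [g t] and of the weight varies; its
   degree keeps the product orthogonal for all nearby [t]. *)
have m1 : moment 1 a (g a * dg a) = - moment 0 a (dg a ^+ 2).
  have P := poly_is_deriveM (dgP a) (poly_is_derive_cst (dg a) a).
  have d := is_derive_moment_poly 0 a1 a2 P.
  have := @derive_val _ _ _ _ _ _ _ d.
  rewrite (@near_eq_derive _ _ _ _ (cst 0)); last first.
    near=> t; have [t1 t2] : -1 < t /\ t < 2 by near: t; exact: near_range.
    by rewrite moment_orthogonal.
  by rewrite derive_cst mulr0 add0r -expr2 => /eqP; rewrite eq_sym addr_eq0 => /eqP.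
(* The second moment thus exceeds the second derivative of [h] by [2 |dg|^2], the term that becomes
   the finite sum. *)
have dh' : is_derive a 1 (fun t => moment 1 t (g t ^+ 2))
    (moment 2 a (g a ^+ 2) - 2 * moment 0 a (dg a ^+ 2)).
  have P := poly_is_deriveM (dgP a) (dgP a).
  have d := is_derive_moment_poly 1 a1 a2 P.
  apply: is_derive_eq; rewrite momentD // [dg a * _]mulrC m1; ring.
have LD := log_derivative2 a1 a2 dh dh'.
have h0 := lt0r_neq0 (h_gt0 a1 a2).
(* Both sides of the equation are differentiated in the parameter and compared by uniqueness; the
   coefficient [1 - 2 t] is the source of the term in [g']. *)
have ode : pearson a (dg a)^`() - 2 *: (g a)^`() = - (n%:R * (n%:R + 2)) *: dg a.
  have dg' := poly_is_derive_deriv (dgP a); have dg'' := poly_is_derive_deriv dg'.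
  have dc : is_derive a 1 (fun t : R => 1 - 2 * t) (- 2).
    by apply: is_derive_eq; rewrite /GRing.scale /=; ring.
  have dL := poly_is_deriveD (poly_is_deriveM (poly_is_derive_cst (1 - 'X^2) a) dg'')
    (poly_is_deriveM (poly_is_deriveD (poly_is_deriveZ 1 dc) (poly_is_derive_cst (- (3%:P * 'X)) a)) dg').
  have dR := poly_is_deriveM (poly_is_derive_cst (- (n%:R * (n%:R + 2)))%:P a) (dgP a).
  have EL : (fun t => (1 - 'X^2) * (g t)^`()^`() + ((1 - 2 * t) *: 1 + - (3%:P * 'X)) * (g t)^`())
      = (fun t => (- (n%:R * (n%:R + 2)))%:P * g t).
    apply/funext => t; rewrite [RHS]mul_polyC -[RHS]grosjean2_ode /pearson.
    by rewrite -mul_polyC mulr1.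
  rewrite EL in dL; have H := poly_is_derive_unique dL dR.
  rewrite !mul0r !addr0 in H; rewrite -[RHS]mul_polyC -H /pearson -!mul_polyC.
  by rewrite !(polyCB, polyCM, polyCN, polyC1, polyC_natr); ring.
have S : 2 * moment 0 a (dg a ^+ 2) / h a = _ :=
  @grosjean2_param_deriv_sq_norm _ a (moment 0 a) (fun p q => momentD 0 p q a1 a2)
    (fun c p => momentZ 0 c p a1 a2) (fun p => moment0_pearson p a1 a2) a1 a2
    (moment0_1_gt0 a1 a2) n (dg a) (size_dg a) ode.
rewrite -S.
have normE t : -1 < t -> t < 2 -> grosjean2_norm n t = Num.sqrt (h t).
  move=> t1 t2; rewrite /grosjean2_norm /h moment0E; congr Num.sqrt.
  apply: eq_Rintegral => x; rewrite inE => Ix.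
  by rewrite horner_exp grosjean2_weightE.
pose k := moment 1 a (g a ^+ 2) / (2 * h a).
rewrite /grosjean2_fisher.
have -> : (\int[mu]_(x in I) ((derive1 (fun s => Num.sqrt (grosjean2_weight s x)
                * (orthonormal_grosjean2 n s).[x]) a) ^+ 2)%:E =
   \int[mu]_(x in I) ((expweight a x / h a *
      (lnratio x / 2 * (g a).[x] + (dg a).[x] - k * (g a).[x]) ^+ 2)%:E))%E.
  apply: eq_integral => x; rewrite inE => Ix; congr EFin.
  have x1 := I_gt0 Ix.
  (* Taking the root halves the exponent, so the root of the weight is again an exponential in [s],
     with the factor [r] constant in [s]. *)
  pose r := Num.sqrt (1 + x); pose e s := expR (s * (lnratio x / 2)).
  have e2 s : expR (s * lnratio x) = e s ^+ 2.
    by rewrite /e expr2 -expRD; congr expR; field.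
  have wE s : Num.sqrt (grosjean2_weight s x) = r * e s.
    rewrite grosjean2_weightE // /expweight e2 sqrtrM ?ltW // sqrtr_sqr ger0_norm ?expR_ge0 //.
  pose S0 := Num.sqrt (h a).
  have S0h : h a = S0 ^+ 2 by rewrite sqr_sqrtr // ltW // h_gt0.
  have S00 : S0 != 0 by rewrite gt_eqF // sqrtr_gt0 h_gt0.
  have de : is_derive a 1 e (lnratio x / 2 * e a).
    have d := is_derive_expR_scaled 1 (lnratio x / 2) a.
    rewrite (_ : e = fun s => 1 * expR (s * (lnratio x / 2))).
      by apply: is_derive_eq; rewrite /= !mul1r.
    by apply/funext => s; rewrite mul1r.
  have dS : is_derive a 1 (fun s => Num.sqrt (h s)) ((2 * S0)^-1 * moment 1 a (g a ^+ 2)).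
    exact: (@is_derive1_comp _ Num.sqrt h a _ _ (is_derive1_sqrt (h_gt0 a1 a2)) (dh _ a1 a2)).
  have dV := @is_deriveV _ (fun s => Num.sqrt (h s)) _ _ _ S00 dS.
  have dx := poly_is_derive_horner x (dgP a).
  have d := is_deriveZ r (is_deriveM de (is_deriveM dV dx)).
  (* The norm is identified with the root of [h] only inside the admissible range, so the two
     functions of [s] are compared near [a]. *)
  rewrite derive1E (@near_eq_derive _ _ _ _
    (r \*: (e * ((fun s => (Num.sqrt (h s))^-1) * (fun s => (g s).[x]))))); last first.
    near=> s; have [s1 s2] : -1 < s /\ s < 2 by near: s; exact: near_range.
    rewrite wE /orthonormal_grosjean2 normE // hornerZ.
    by rewrite -[LHS]mulrA.
  rewrite derive_val /GRing.scale fctE /= /expweight e2 -/S0 /k S0h.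
  have -> : 1 + x = r ^+ 2 by rewrite sqr_sqrtr // ltW.
  move: (e a) (lnratio x) (g a).[x] (dg a).[x] (moment 1 a _) (r) (S0) S00 => E L u v m rr T T0.
  by field.
rewrite (@fisher_integral a k (dg a)) // -EFinM; congr EFin.
rewrite -addrA -LD.
move: (moment 0 a (dg a ^+ 2)) (moment 1 a _) (moment 2 a _) (h a) h0 => D0 M1 M2 H H0.
by field.
Unshelve. all: by end_near. Qed.

End Fisher.

Theorem mainTheorem5 (R : realType) (a : R) (n : nat) :
  -1 < a -> a < 2 ->
  grosjean2_fisher n a =
    (8 * \sum_(0 <= k < n)
           (k.+1%:R ^+ 2 / ((n - k)%:R ^+ 2 * (n + k + 2)%:R ^+ 2)
            * ((pochhammer (k%:R + 2 - a) (n - k)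
                - (-1) ^+ (n - k) * pochhammer (k%:R + a + 1) (n - k)) ^+ 2
               / (pochhammer (k%:R + a + 1) (n - k)
                  * pochhammer (k%:R + 2 - a) (n - k))))
     + trigamma (n%:R + 2 - a) + trigamma (n%:R + a + 1))%:E.
Proof. exact: grosjean2_fisherE. Qed.
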